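(* Given $p_0>0$, there exist universal constants $c=c(p_0)>0$ and $c'=c'(p_0)>0$, depending only on $p_0$, such that for all choices of (a) a separable abelian metric semigroup $(\mathscr{G},d_{\mathscr{G}})$ with elements $z_0,z_1\in\mathscr{G}$, (b) a finite sequence of independent $\mathscr{G}$-valued random variables $X_1,\dots,X_n$, (c) real numbers $q\geqslant p\geqslant p_0$, and (d) $\epsilon\in(-q,\log(16)]$, we have \[ \mathbb{E}_\mu[U_n^q]^{1/q} \leqslant c\,\frac{q}{\max(p,\log(\epsilon+q))}\left(\mathbb{E}_\mu[U_n^p]^{1/p}+M_n^*(e^{-q}/8)\right)+c\,\mathbb{E}_\mu[M_n^q]^{1/q}, \] and, if moreover $\epsilon\geqslant\min(1,e-p_0)$, then the right-hand side above is in turn at most \[ c'\,\frac{q}{\max(p,\log(\epsilon+q))}\left(\mathbb{E}_\mu[U_n^p]^{1/p}+\mathbb{E}_\mu[M_n^q]^{1/q}\right). \] Moreover, for given $\epsilon$, in the last bound one may choose for $c'$ the value \[ c(p_0)\cdot\left(8^{1/p_0}e+\max\left(1,\frac{\log(\epsilon+p_0)}{p_0}\right)\right). \]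
   Context: A metric semigroup is a semigroup $(\mathscr{G},\cdot)$ (a set with an associative binary operation) equipped with a metric $d_{\mathscr{G}}:\mathscr{G}\times\mathscr{G}\to[0,\infty)$ that is translation-invariant: $d_{\mathscr{G}}(ac,bc)=d_{\mathscr{G}}(a,b)=d_{\mathscr{G}}(ca,cb)$ for all $a,b,c\in\mathscr{G}$. It need not have an identity; it is abelian if the operation is commutative, and separable if the metric space is separable. Random variables are defined on a probability space $(\Omega,\mathscr{A},\mu)$ and are Borel measurable; $\mathbb{P}_\mu,\mathbb{E}_\mu$ denote probability and expectation with respect to $\mu$. For fixed $z_0,z_1\in\mathscr{G}$ and $\mathscr{G}$-valued random variables $X_1,\dots,X_n$, set \[ S_j:=X_1X_2\cdots X_j,\qquad U_n:=\max_{1\leqslant i\leqslant n}d_{\mathscr{G}}(z_1,z_0S_i),\qquad M_n:=\max_{1\leqslant i\leqslant n}d_{\mathscr{G}}(z_0,z_0X_i). \] For a $[0,\infty)$-valued random variable $X$, its decreasing rearrangement is $X^*(t):=\sup\{y\in[0,\infty):\mathbb{P}_\mu(X>y)>t\}$ for $t\in[0,1]$ (with $\sup\emptyset=0$). Moments are allowed to be $+\infty$. *)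

(* Defs.v *)
From HB Require Import structures.
From mathcomp Require Import all_boot all_order all_algebra.
From mathcomp Require Import all_classical all_reals all_analysis.

Set Implicit Arguments.
Unset Strict Implicit.
Unset Printing Implicit Defensive.

Import Order.TTheory GRing.Theory Num.Theory.
Import numFieldNormedType.Exports.

Local Open Scope classical_set_scope.
Local Open Scope ring_scope.

HB.mixin Record isTranslationInvariant (R : realType) G
    of Metric R G & Semigroup G := {
  mdist_mulr : forall a b c : G, mdist (a * c)%g (b * c)%g = mdist a b ;
  mdist_mull : forall a b c : G, mdist (c * a)%g (c * b)%g = mdist a b
}.

#[short(type="metricSemigroupType")]
HB.structure Definition MetricSemigroup (R : realType) :=
  {G of Metric R G & Semigroup G & isTranslationInvariant R G}.

Definition abelian_semigroup (G : semigroupType) : Prop :=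
  forall a b : G, commute a b.

Definition separable (G : topologicalType) : Prop :=
  exists2 D : set G, countable D & dense D.

Definition borel (G : topologicalType) : set (set G) := <<s @open G >>.

(* [measurable_fun] is not used here because a [measurableType] is pointed,
   whereas a metric semigroup is not. *)
Definition random_element d (T : measurableType d) (G : topologicalType)
    (X : T -> G) : Prop :=
  forall B : set G, borel B -> measurable (X @^-1` B).

Definition independent d (T : measurableType d) (R : realType)
    (P : probability T R) (G : topologicalType) (I : finType)
    (X : I -> T -> G) : Prop :=
  forall (J : {set I}) (B : I -> set G), (forall i, borel (B i)) ->
    P (\bigcap_(i in [set` J]) X i @^-1` B i) =
    (\prod_(i in J) P (X i @^-1` B i))%E.

Fixpoint prefix_prod (G : magmaType) (x : nat -> G) (j : nat) : G :=
  if j is k.+1 then (prefix_prod x k * x k.+1)%g else x 0%N.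

(* The variables X_1, ..., X_N (N >= 1) are indexed from 0, with N = n.+1, so
   that [partial_prod X j] is X_1 X_2 ... X_(j+1). *)
Definition partial_prod (T : Type) (G : magmaType) (n : nat)
    (X : 'I_n.+1 -> T -> G) (j : 'I_n.+1) (w : T) : G :=
  prefix_prod (fun k => X (inord k) w) j.

(* Distances are nonnegative, hence 0 is a neutral initial value for the
   maximum over the nonempty index set. *)
Definition max_partial_dist (R : realType) (G : metricSemigroupType R)
    (T : Type) (n : nat) (z0 z1 : G) (X : 'I_n.+1 -> T -> G) (w : T) : R :=
  \big[Num.max/0]_(i < n.+1) mdist z1 (z0 * partial_prod X i w)%g.

Definition max_step_dist (R : realType) (G : metricSemigroupType R)
    (T : Type) (n : nat) (z0 : G) (X : 'I_n.+1 -> T -> G) (w : T) : R :=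
  \big[Num.max/0]_(i < n.+1) mdist z0 (z0 * X i w)%g.

(* The supremum is taken in [0, +oo]: as [ereal_sup set0] is -oo, the outer
   maximum only serves to implement the convention sup set0 = 0. *)
Definition decreasing_rearrangement d (T : measurableType d) (R : realType)
    (P : probability T R) (X : T -> R) (t : R) : \bar R :=
  maxe 0%E (ereal_sup
    [set y%:E | y in [set y : R | 0 <= y /\ (t%:E < P [set w | (y < X w)%R])%E]]).

Definition moment_root d (T : measurableType d) (R : realType)
    (P : probability T R) (X : T -> R) (q : R) : \bar R :=
  ('E_P[fun w => (X w `^ q)%R] `^ q^-1%R)%E.

(* Main.v *)
Require Import Defs.
From HB Require Import structures.
From mathcomp Require Import all_boot all_order all_algebra.
From mathcomp Require Import all_classical all_reals all_analysis.
From mathcomp Require Import measurable_realfun ring lra.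

Set Implicit Arguments.
Unset Strict Implicit.
Unset Printing Implicit Defensive.

Import Order.TTheory GRing.Theory Num.Theory.
Import numFieldNormedType.Exports.

Local Open Scope classical_set_scope.
Local Open Scope ring_scope.

(** The moment of order q of U, the largest distance reached by the partial
    products S_j, is controlled through two tail estimates.

    As d(x, xc) does not depend on x, the distance from S_i to S_l, for i < l, is
    the distance from z0 to z0 X_(i+1) ... X_l: it depends on the block between
    i and l only, so the increments of the path after time i are independent of
    what it did before.

    First estimate. Let a be a level of order the p-th moment root of U, with
    P(U > a) <= exp(-p) / 2. A path whose steps are at most s and which goes
    further than a multiple of k (a + s) must contain a chain of k consecutive
    exceedances: from each chosen time it gets further than 2a from its current
    position, and the next chosen time is the first one where this happens. An
    exceedance between the times i and m forces U > a, and comparing it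
    with the first time at which the path leaves the ball of radius a around z1
    bounds the distribution function of the next chosen time, for every i, by
    that of one measure on times, of mass at most P(U > a) / P(U <= a). As the
    chosen times increase, k exceedances cost the k-th power of this mass
    divided by k! ([pr_chain_le]); hence a Hoffmann-Jorgensen inequality with a
    factorial gain ([pr_max_gt_chain]). For k of order
    q / max (p, ln (q + ln 16)) the cost is at most exp(-q) / 4: when p is the
    larger term because of the power, when the logarithm is because of the
    factorial ([chain_bound_le]). Taking for s a value just above the
    rearrangement of M at exp(-q) / 8 produces a level t0 of the order of the
    first term of the bound, with 2^q P(U > t0) <= 1/2 ([pr_gt_high_level]).

    Second estimate. To exceed 2t, for t >= 4 t0, with steps at most t / 2 the
    path must first exceed t and then move by more than 2 t0, so that
    P(U > 2t) <= P(U > t0) P(U > t) + P(M > t/2) ([pr_max_gt_two_blocks]).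
    Integrating this over t, the first term is absorbed by the left-hand side,
    because 2^q P(U > t0) <= 1/2 and E U^q is finite as soon as E M^q is; what
    is left bounds the moment root of U by t0 and the moment root of M
    ([moment_root_le_of_halving]).

    The bound gets weaker when eps decreases, so it is enough to treat
    eps = ln 16. The second bound follows from Chebyshev's inequality for the
    rearrangement ([rearrangement_le_moment]) and from the concavity of the
    logarithm, which compares q / max (p, ln (eps + q)) with a constant
    ([ln_add_le]). *)

(** * Random elements of a separable metric semigroup *)

Section metric_semigroup.
Context (R : realType) (G : metricSemigroupType R).
Implicit Types a b c : G.

Lemma open_mdist_lt a (r : R) : open [set y : G | mdist a y < r].
Proof.
rewrite openE => y /= ry; rewrite /interior -nbhs_ballE.
exists (r - mdist a y) => /=; first by rewrite subr_gt0.
move=> z; rewrite ballEmdist/= => yz.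
have := metric_triangle a y z; lra.
Qed.

Lemma open_translated_mdist_gt c a (r : R) :
  open [set y : G | r < mdist a (c * y)%g].
Proof.
rewrite openE => y /= ry; rewrite /interior -nbhs_ballE.
exists (mdist a (c * y)%g - r) => /=; first by rewrite subr_gt0.
move=> z; rewrite ballEmdist/= => yz.
have := metric_triangle a (c * z)%g (c * y)%g.
rewrite mdist_mull (metric_sym z y); lra.
Qed.

Lemma mdist_mul_le a b c d : mdist (a * b)%g (c * d)%g <= mdist a c + mdist b d.
Proof.
by rewrite (le_trans (metric_triangle _ (c * b)%g _))// mdist_mulr mdist_mull.
Qed.

Lemma borel_open (B : set G) : open B -> borel B.
Proof. exact: sub_sigma_algebra. Qed.

Lemma dense_sequence : G -> separable G ->
  exists x : nat -> G, forall g (r : R), 0 < r -> exists k, mdist (x k) g < r.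
Proof.
move=> g0 [D cD dD].
have near g (r : R) : 0 < r -> exists2 x, D x & mdist x g < r.
  move=> r0; have := dD _ _ (open_mdist_lt g r).
  by case=> [|x [/= xr Dx]]; [exists g; rewrite /= mdistxx|
    exists x => //; rewrite metric_sym].
have D0 : D !=set0 by have [x Dx _] := near g0 1 ltr01; exists x.
have /pfcard_geP[D00|[x]] := cD; first by move: D0; rewrite D00 => -[].
exists x => g r r0; have [y /(@surj _ _ _ _ x)[k _ <-] yr] := near g r r0.
by exists k.
Qed.

Context d (T : measurableType d).

(** The product is jointly continuous; separability makes the preimage of an open
   set a countable union of measurable rectangles. *)
Lemma random_elementM (X Y : T -> G) : separable G ->
  random_element X -> random_element Y ->
  random_element (fun w => X w * Y w)%g.
Proof.
move=> sepG mX mY.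
pose Z w := (X w * Y w)%g.
have [x dx] := dense_sequence (X point) sepG.
move=> B bB.
suff : image_set_system setT Z measurable B.
  by rewrite /image_set_system/= setTI.
move: B bB; apply: smallest_sub => [|O oO].
  exact/sigma_algebra_image/sigma_algebra_measurable.
rewrite /image_set_system/= setTI.
(* V i j k is the event that (X, Y) lies in a rectangle of radius 1 / (k + 1)
   centred at (x i, x j); Q i j k says that the ball of twice this radius, where
   the product then lies, is contained in O. *)
pose V i j k := [set w | mdist (x i) (X w) < k.+1%:R^-1] `&`
                [set w | mdist (x j) (Y w) < k.+1%:R^-1].
pose Q i j k := forall g, mdist (x i * x j)%g g < 2 / k.+1%:R -> O g.
have -> : Z @^-1` O =
    \bigcup_i \bigcup_j \bigcup_(k in [set k | Q i j k]) V i j k.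
  apply/seteqP; split => [w|w [i _ [j _ [k /= Qk [/= Xw Yw]]]]]; last first.
    apply: Qk; rewrite (le_lt_trans (mdist_mul_le _ _ _ _))//.
    by rewrite mulr_natl mulr2n ltrD.
  move: oO; rewrite openE => /[apply]; rewrite /interior -nbhs_ballE.
  move=> [e /= e0 eO].
  (* Twice the radius to reach x i * x j from Z w, and twice again to stay in
     the ball around it. *)
  pose k := Num.truncn (4 / e).
  have ke : 4 / k.+1%:R < e.
    rewrite ltr_pdivrMr// mulrC -ltr_pdivrMr//.
    by have /andP[] := truncn_itv (divr_ge0 (ler0n R 4) (ltW e0)).
  have k0 : 0 < k.+1%:R^-1 :> R by rewrite invr_gt0.
  have [i Xi] := dx (X w) _ k0; have [j Yj] := dx (Y w) _ k0.
  exists i => //; exists j => //; exists k => //= g ijg.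
  apply: eO; rewrite ballEmdist/=.
  have := metric_triangle (Z w) (x i * x j)%g g.
  have := mdist_mul_le (X w) (Y w) (x i) (x j).
  rewrite (metric_sym (X w)) (metric_sym (Y w)) -/(Z w).
  by move: ijg ke Xi Yj; move: (k.+1%:R^-1) => r; lra.
apply: bigcup_measurable => i _; apply: bigcup_measurable => j _.
apply: bigcup_measurable => k _; apply: measurableI.
  exact: (mX _ (borel_open (open_mdist_lt (x i) k.+1%:R^-1))).
exact: (mY _ (borel_open (open_mdist_lt (x j) k.+1%:R^-1))).
Qed.

End metric_semigroup.

(** * Independence of generated sigma-algebras *)

Section independence.
Context d (T : measurableType d) (R : realType) (P : probability T R).

(** The events that satisfy the product rule with a fixed B form a Dynkin
    system, so the rule extends from a pi-system to the sigma-algebra that it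
    generates. *)
Lemma product_rule_sigma_algebra (C : set (set T)) (B : set T) :
  setI_closed C -> C `<=` measurable -> measurable B ->
  (forall A, C A -> P (A `&` B) = P A * P B)%E ->
  forall A, <<s C >> A -> measurable A /\ (P (A `&` B) = P A * P B)%E.
Proof.
move=> CI mC mB CB; rewrite -setI_closed_g_dynkin_g_sigma_algebra//.
apply: smallest_sub => [|A CA]; last by split; [exact: mC|exact: CB].
have PB : P B = (fine (P B))%:E by rewrite fineK ?fin_num_measure.
split => [|A [mA AB]|F tF FB].
- by split; [exact: measurableT|rewrite setTI probability_setT mul1e].
- split; first exact: measurableC.
  rewrite setIC -setDE measureD// ?probability_setC//; last first.
    by rewrite ltey_eq fin_num_measure.
  transitivity (P B - P (A `&` B))%E; first by rewrite (setIC A).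
  rewrite AB muleBl ?mul1e ?fin_num_measure// fin_num_adde_defr//.
- have mF n : measurable (F n) by have [] := FB n.
  split; first exact: bigcup_measurable.
  rewrite setI_bigcupl !measure_bigcup//; last 2 first.
  + by move=> i _; exact: measurableI.
  + exact: trivIset_setIr.
  rewrite PB muleC -nneseriesZl//.
  apply: eq_eseriesr => i _; transitivity (P (F i `&` B)) => //.
  by rewrite (proj2 (FB i)) PB muleC.
Qed.

Context (G : topologicalType) (I : finType) (X : I -> T -> G).

(** The events that constrain each [X i], for i in J, separately: a generating
    pi-system of the sigma-algebra of the family (X i), i in J. *)
Definition cylinder (J : {set I}) : set (set T) :=
  [set C | exists B : I -> set G, (forall i, borel (B i)) /\
    C = \bigcap_(i in [set` J]) X i @^-1` B i].

Lemma borelI : setI_closed (@borel G).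
Proof.
have /(sigma_algebraP _) : sigma_algebra setT (@borel G).
  exact: smallest_sigma_algebra.
by case.
Qed.

Lemma borelT : borel [set: G].
Proof. by apply: sub_sigma_algebra; exact: openT. Qed.

Lemma cylinderI (J : {set I}) : setI_closed (cylinder J).
Proof.
move=> _ _ [A [mA ->]] [B [mB ->]].
exists (fun i => A i `&` B i); split => [i|]; first exact: borelI.
by rewrite -bigcapI; apply: eq_bigcapr => i _; rewrite preimage_setI.
Qed.

Lemma cylinder_measurable (J : {set I}) : (forall i, random_element (X i)) ->
  cylinder J `<=` measurable.
Proof.
move=> mX _ [B [mB ->]]; apply: fin_bigcap_measurable => // i _.
exact: mX.
Qed.

(** The product rule holds between cylinders over J1 and over J2, and is extended
    to the generated sigma-algebras one factor after the other. *)
Lemma independent_sigma_algebra (J1 J2 : {set I}) :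
  (forall i, random_element (X i)) -> independent P X ->
  (forall i, i \in J1 -> i \notin J2) -> forall A B,
  <<s cylinder J1 >> A -> <<s cylinder J2 >> B -> (P (A `&` B) = P A * P B)%E.
Proof.
move=> mX indX J12 A B sA sB.
have mB : measurable B.
  apply: (smallest_sub (@sigma_algebra_measurable _ T) _ sB).
  exact: cylinder_measurable.
apply: (proj2 (product_rule_sigma_algebra (@cylinderI J1)
                 (cylinder_measurable mX) mB _ sA)).
move=> {A sA} A J1A; rewrite setIC muleC.
have mA := cylinder_measurable mX J1A.
apply: (proj2 (product_rule_sigma_algebra (@cylinderI J2)
                 (cylinder_measurable mX) mA _ sB)).
move=> {B sB mB} _ [B2 [mB2 ->]]; case: J1A {mA} => B1 [mB1 ->].
pose B i := if i \in J1 then B1 i else B2 i.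
have mB i : borel (B i) by rewrite /B; case: ifP.
have B1E i : i \in J1 -> B i = B1 i by rewrite /B => ->.
have B2E i : i \in J2 -> B i = B2 i.
  by rewrite /B => iJ2; case: ifPn => // /J12; rewrite iJ2.
have := indX (finset.setU J1 J2) B mB.
rewrite (eq_bigl [predU J1 & J2]) => [|i]; last by rewrite !inE.
rewrite bigU/=; last first.
  apply/pred0P => i /=; apply/negbTE.
  by rewrite negb_and -implybE; apply/implyP/J12.
rewrite (eq_bigr (fun i => P (X i @^-1` B1 i))) => [|i /B1E ->//].
rewrite [X in (_ * X)%E](eq_bigr (fun i => P (X i @^-1` B2 i)));
  last by move=> i /B2E ->.
rewrite -(indX J1 B1 mB1) -(indX J2 B2 mB2) muleC => <-; congr (P _).
apply/seteqP; split => w /=.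
  move=> [w2 w1] i /=; rewrite inE => /orP[iJ|iJ].
    by rewrite B1E//; exact: w1.
  by rewrite B2E//; exact: w2.
move=> wB; split => i /= iJ.
  by rewrite -B2E//; apply: wB; rewrite /= inE iJ orbT.
by rewrite -B1E//; apply: wB; rewrite /= inE iJ.
Qed.

End independence.

(** * Real-valued probabilities *)

Section real_probability.
Context d (T : measurableType d) (R : realType) (P : probability T R).
Implicit Types A B : set T.

(** Quotients and powers of probabilities occur below, hence real values. *)
Definition pr A : R := fine (P A).

Lemma EFin_pr A : measurable A -> (pr A)%:E = P A.
Proof. by move=> mA; rewrite fineK// fin_num_measure. Qed.

Lemma pr_ge0 A : 0 <= pr A.
Proof. exact: fine_ge0. Qed.

Lemma pr_le A B : measurable A -> measurable B -> A `<=` B -> pr A <= pr B.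
Proof.
by move=> mA mB AB; rewrite -lee_fin !EFin_pr// le_measure// inE.
Qed.

Lemma pr_le1 A : measurable A -> pr A <= 1.
Proof. by move=> mA; rewrite -lee_fin EFin_pr// probability_le1. Qed.

Lemma prC A : measurable A -> pr (~` A) = 1 - pr A.
Proof.
move=> mA; apply: EFin_inj; rewrite EFinB !EFin_pr//; last exact: measurableC.
exact: probability_setC.
Qed.

Lemma prD A B : measurable A -> measurable B -> B `<=` A ->
  pr (A `\` B) = pr A - pr B.
Proof.
move=> mA mB BA; apply: EFin_inj; rewrite EFinB !EFin_pr//; last first.
  exact: measurableD.
rewrite measureD//; last by rewrite ltey_eq fin_num_measure.
by rewrite setIidr.
Qed.

Lemma prU_le A B : measurable A -> measurable B ->
  pr (A `|` B) <= pr A + pr B.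
Proof.
move=> mA mB; rewrite -lee_fin EFinD !EFin_pr//; last exact: measurableU.
exact: measureU2.
Qed.

Lemma pr_exists_le (A : nat -> set T) i m :
  (forall l, (i <= l < m)%N -> measurable (A l)) ->
  pr [set w | exists2 l, (i <= l < m)%N & A l w] <= \sum_(i <= l < m) pr (A l).
Proof.
elim: m => [|m IH] mA.
  rewrite big_geq// (_ : [set _ | _] = set0) ?/pr ?measure0//.
  by apply/seteqP; split => // w [l]; rewrite ltn0 andbF.
have [mi|im] := ltnP m i.
  rewrite big_geq// (_ : [set _ | _] = set0) ?/pr ?measure0//.
  apply/seteqP; split => // w [l] /andP[il lm].
  by have := leq_trans mi (leq_trans il lm); rewrite ltnn.
have mA' l : (i <= l < m)%N -> measurable (A l).
  by move=> /andP[il lm]; apply: mA; rewrite il ltnS ltnW.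
have mU : measurable [set w | exists2 l, (i <= l < m)%N & A l w].
  rewrite (_ : [set _ | _] = \bigcup_(l in [set l | (i <= l < m)%N]) A l)//.
  by apply: bigcup_measurable => l; exact: mA'.
have mAm : measurable (A m) by apply: mA; rewrite im ltnSn.
rewrite big_nat_recr//= (le_trans _ (lerD (IH mA') (lexx _)))//.
apply: le_trans (prU_le mU mAm); apply: pr_le => //.
- rewrite (_ : [set _ | _] = \bigcup_(l in [set l | (i <= l < m.+1)%N]) A l)//.
  by apply: bigcup_measurable => l; exact: mA.
- exact: measurableU.
- move=> w [l /andP[il]]; rewrite ltnS leq_eqVlt => /orP[/eqP->|lm] Alw.
    by right.
  by left; exists l => //; rewrite il.
Qed.

End real_probability.

(** * A power-sum estimate *)

Lemma subr_exprS_ge (R : realFieldType) (x y : R) k : 0 <= y -> y <= x ->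
  (x - y) * y ^+ k *+ k.+1 <= x ^+ k.+1 - y ^+ k.+1.
Proof.
move=> y0 yx; rewrite subrXX -mulrnAr ler_wpM2l ?subr_ge0//.
rewrite -[X in _ *+ X]card_ord -sumr_const; apply: ler_sum => i _.
rewrite -[in leLHS](@subnK i k) -1?ltnS// exprD.
rewrite ?subSS ?succnK.
by rewrite ler_wpM2r ?exprn_ge0// lerXn2r ?nnegrE// (le_trans y0).
Qed.

(** With c m := L - e m, which is at least lam m, the m-th term is at most
    (c m - c m.+1) * c m.+1 ^+ k, that is at most the decrement of
    c ^+ k.+1 / k.+1 between m and m.+1; these decrements telescope. Iterating
    this estimate produces the factorial of [pr_chain_le]. *)
Lemma sum_increments_expr_le (R : realFieldType) (e lam : nat -> R) (L : R) i n k :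
  (i <= n)%N -> e i = 0 ->
  (forall m, (i <= m < n)%N -> e m <= e m.+1) ->
  (forall m, (i <= m <= n)%N -> 0 <= lam m <= L - e m) ->
  \sum_(i <= m < n) (e m.+1 - e m) * lam m.+1 ^+ k <= L ^+ k.+1 / k.+1%:R.
Proof.
move=> lein ei0 e_nd lamL.
suff H m : (i <= m <= n)%N ->
    \sum_(i <= j < m) (e j.+1 - e j) * lam j.+1 ^+ k <=
    (L ^+ k.+1 - (L - e m) ^+ k.+1) / k.+1%:R.
  apply: le_trans (H n _) _; first by rewrite lein leqnn.
  rewrite ler_wpM2r ?invr_ge0// lerBlDr lerDl exprn_ge0//.
  have /andP[l0 lL] : 0 <= lam n <= L - e n by apply: lamL; rewrite lein leqnn.
  exact: le_trans lL.
elim: m => [|m IH] /andP[im mn].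
  move: im; rewrite leqn0 => /eqP i0.
  by rewrite big_geq// -i0 ei0 subr0 subrr mul0r.
move: im; rewrite leq_eqVlt ltnS => /orP[/eqP <-|im].
  by rewrite big_geq// ei0 subr0 subrr mul0r.
rewrite big_nat_recr//=; apply: le_trans (lerD (IH _) (lexx _)) _.
  by rewrite im ltnW.
have /andP[l0 lL] : 0 <= lam m.+1 <= L - e m.+1 by apply: lamL; rewrite mn ltnW.
have ee : e m <= e m.+1 by apply: e_nd; rewrite im.
rewrite -lerBrDl -mulrBl ler_pdivlMr ?ltr0n//.
have := @subr_exprS_ge _ (L - e m) (L - e m.+1) k (le_trans l0 lL).
rewrite lerD2l lerN2 => /(_ ee).
have -> : L - e m - (L - e m.+1) = e m.+1 - e m by ring.
rewrite -[_ *+ k.+1]mulr_natr => h.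
have : (e m.+1 - e m) * lam m.+1 ^+ k * k.+1%:R <=
       (e m.+1 - e m) * (L - e m.+1) ^+ k * k.+1%:R.
  rewrite ler_wpM2r// ler_wpM2l ?subr_ge0// lerXn2r// nnegrE//.
  exact: le_trans lL.
move: h; lra.
Qed.

(** * Paths of partial products *)

(** The length of a step does not depend on where it starts: multiplying by c on
    the right and cancelling the starting point on the left compares it with the
    step from c to c * c. *)
Lemma mdist_step (R : realType) (G : metricSemigroupType R) (a b c : G) :
  mdist a (a * c)%g = mdist b (b * c)%g.
Proof.
have stepE x : mdist x (x * c)%g = mdist c (c * c)%g.
  by rewrite -(mdist_mulr _ _ c) -mulgA mdist_mull.
by rewrite !stepE.
Qed.

Lemma prefix_prodD (G : semigroupType) (x : nat -> G) i m :
  prefix_prod x (i + m.+1) =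
  (prefix_prod x i * prefix_prod (fun k => x (i.+1 + k)%N) m)%g.
Proof.
elim: m => [|m IH]; first by rewrite addn1 /= addn0.
by rewrite addnS /= IH -mulgA ?addSn.
Qed.

Section paths.
Context (R : realType) (G : metricSemigroupType R) (z0 z1 : G) (T : Type).
Context (n : nat) (X : 'I_n.+1 -> T -> G).

(** The same products as [partial_prod], but for natural number indices, so that
    blocks can be cut at i and i + m.+1. *)
Definition partial_product j w : G := prefix_prod (fun k => X (inord k) w) j.

Definition gap i l w : R := mdist (partial_product i w) (partial_product l w).

Definition level j w : R := mdist z1 (z0 * partial_product j w)%g.

Definition exceeds (b : R) i m : set T :=
  [set w | exists2 l, (i < l <= m)%N & b < gap i l w].

(** A greedy chain of k exceedances starting at time i. Taking for l.+1 the first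
    exceedance after i makes this choice depend on the variables up to l.+1 only,
    and the rest of the chain depends on the later ones. *)
Fixpoint chain (b : R) k i : set T :=
  if k is k'.+1 then
    [set w | exists2 l, (i <= l < n)%N &
      ((exceeds b i l.+1 `\` exceeds b i l) `&` chain b k' l.+1) w]
  else setT.

Definition hits (t : R) m : set T :=
  [set w | exists2 j, (j < m)%N & t < level j w].

Lemma gapxx i w : gap i i w = 0.
Proof. exact: mdistxx. Qed.

Lemma gap_triangle i m l w : gap i l w <= gap i m w + gap m l w.
Proof. exact: metric_triangle. Qed.

Lemma gap_le_level i l w : gap i l w <= level i w + level l w.
Proof.
rewrite /gap /level -(mdist_mull _ _ z0).
rewrite (metric_sym z1 (z0 * partial_product i w)%g).
exact: metric_triangle.
Qed.

Lemma level_le_gap i l w : level l w <= level i w + gap i l w.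
Proof.
rewrite /gap /level -(mdist_mull (partial_product i w) _ z0).
exact: metric_triangle.
Qed.

Lemma not_exceeds b i m w l :
  ~ exceeds b i m w -> (i < l <= m)%N -> gap i l w <= b.
Proof. by move=> ne il; rewrite leNgt; apply/negP => bg; apply: ne; exists l. Qed.

Lemma exceedsS b i m : exceeds b i m `<=` exceeds b i m.+1.
Proof. by move=> w [l /andP[il lm] ?]; exists l => //; rewrite il ltnW. Qed.

Lemma first_exceedance b i m w : exceeds b i m w ->
  exists2 l, (i <= l < m)%N & (exceeds b i l.+1 `\` exceeds b i l) w.
Proof.
elim: m => [[l /andP[il]]|m IH].
  by rewrite leqn0 => /eqP l0; rewrite l0 in il.
move=> em; have [em'|em'] := pselect (exceeds b i m w).
  by have [l /andP[il lm] ?] := IH em'; exists l => //; rewrite il ltnW.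
exists m => //; rewrite ltnSn andbT; case: em => l /andP[il lm] _.
by rewrite -ltnS (leq_trans il).
Qed.

Lemma first_hit t m w : hits t m w ->
  exists2 l, (l < m)%N & (hits t l.+1 `\` hits t l) w.
Proof.
elim: m => [[l //]|m IH] hm.
have [hm'|hm'] := pselect (hits t m w).
  by have [l lm ?] := IH hm'; exists l => //; rewrite ltnW.
by exists m.
Qed.

(** Cut at its successive exceedances, a path without a chain of k of them has at
    most k pieces; each piece stays within b of its first point, and a single
    step leads to the next one. *)
Lemma gap_le_not_chain b s k i l w : 0 <= b -> 0 <= s ->
  (forall j, (j < n)%N -> gap j j.+1 w <= s) -> ~ chain b k i w ->
  (i <= l <= n)%N -> gap i l w <= k%:R * (b + s).
Proof.
move=> b0 s0 step; elim: k i l => [|k IH] i l /=; first by move/(_ I).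
move=> nch /andP[il ln].
have bs0 : 0 <= k%:R * (b + s) by rewrite mulr_ge0// addr_ge0.
have small m j : ~ exceeds b i m w -> (i <= j <= m)%N -> gap i j w <= b.
  move=> ne /andP[]; rewrite leq_eqVlt => /orP[/eqP<- _|ij jm].
    by rewrite gapxx.
  by apply: not_exceeds ne _; rewrite ij.
have [en|nen] := pselect (exceeds b i n w); last first.
  have := small _ l nen; rewrite il ln => /(_ isT).
  by rewrite -natr1; move: bs0; lra.
have [m /andP[im mn] fem] := first_exceedance en.
have nem : ~ exceeds b i m w by case: fem.
have [lm|ml] := leqP l m.
  have := small _ l nem; rewrite il lm => /(_ isT).
  by rewrite -natr1; move: bs0; lra.
have nchm : ~ chain b k m.+1 w.
  by move=> chm; apply: nch; exists m => //; rewrite im.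
have gl : gap m.+1 l w <= k%:R * (b + s) by apply: IH => //; rewrite ml.
have gm : gap i m w <= b by apply: small nem _; rewrite im leqnn.
have gs := step m mn.
have := gap_triangle i m l w; have := gap_triangle m m.+1 l w.
by rewrite -natr1; move: gl gm gs; lra.
Qed.

Lemma gap_stepE j w : (j < n)%N ->
  gap j j.+1 w = mdist z0 (z0 * X (inord j.+1) w)%g.
Proof.
by move=> jn; rewrite /gap /partial_product/=; exact: mdist_step.
Qed.

(** This makes a gap independent of the variables outside its block. *)
Lemma gap_blockE i m w :
  gap i (i + m.+1) w =
  mdist z0 (z0 * prefix_prod (fun k => X (inord (i.+1 + k)) w) m)%g.
Proof.
by rewrite /gap /partial_product prefix_prodD; exact: mdist_step.
Qed.

Lemma exceeds_sub_hits a i m : exceeds (a + a) i m `<=` hits a m.+1.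
Proof.
move=> w [l /andP[il lm] ag].
have [al|la] := ltP a (level l w); first by exists l.
exists i; first by rewrite ltnS (leq_trans (ltnW il)).
have := gap_le_level i l w; move: ag la; lra.
Qed.

Lemma exceeds_sub_hitsD a i m :
  exceeds (a + a) i m `\` hits a i.+1 `<=` hits a m.+1 `\` hits a i.+1.
Proof. by move=> w [/exceeds_sub_hits]. Qed.

Lemma hits_le t m m' : (m <= m')%N -> hits t m `<=` hits t m'.
Proof. by move=> mm w [j jm tj]; exists j => //; exact: leq_trans mm. Qed.

End paths.

Section measurability.
Context (R : realType) (G : metricSemigroupType R) (z0 z1 : G).
Context d (T : measurableType d) (n : nat) (X : 'I_n.+1 -> T -> G).
Hypothesis sepG : separable G.

Lemma random_element_prefix_prod d' (T' : measurableType d')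
    (Y : nat -> T' -> G) m :
  (forall k, (k <= m)%N -> random_element (Y k)) ->
  random_element (fun w => prefix_prod (fun k => Y k w) m).
Proof.
elim: m => [|m IH] mY; first exact: mY.
apply: random_elementM => //; last exact: mY.
by apply: IH => k km; apply: mY; exact: leqW.
Qed.

Definition before i : {set 'I_n.+1} := [set j : 'I_n.+1 | (j <= i)%N]%SET.
Definition after i : {set 'I_n.+1} := [set j : 'I_n.+1 | (i < j)%N]%SET.

Lemma random_element_cylinder (J : {set 'I_n.+1}) i : i \in J ->
  @random_element _ (g_sigma_algebraType (cylinder X J)) G (X i).
Proof.
move=> iJ B mB; apply: sub_sigma_algebra.
exists (fun j => if j == i then B else setT); split => [j|].
  by case: ifP => // _; exact: borelT.
apply/seteqP; split => w /=; first by move=> Bw j /= _; case: eqP => // ->.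
by move=> /(_ i iJ) /=; rewrite eqxx.
Qed.

Lemma measurable_exceeds (J : {set 'I_n.+1}) b i m : (m <= n)%N ->
  (forall j : 'I_n.+1, (i < j <= m)%N -> j \in J) ->
  <<s cylinder X J >> (exceeds X b i m).
Proof.
move=> mn JX; pose TJ := g_sigma_algebraType (cylinder X J).
suff : measurable (exceeds X b i m : set TJ) by [].
rewrite (_ : exceeds X b i m =
  \bigcup_(l in [set l | (i < l <= m)%N]) [set w | b < gap X i l w])//.
apply: bigcup_measurable => l /= /andP[il lm].
pose Y (k : nat) : TJ -> G := X (inord (i.+1 + k)).
pose Z (w : TJ) := prefix_prod (fun k => Y k w) (l - i.+1).
have mZ : random_element Z.
  apply: random_element_prefix_prod => k; rewrite leq_subRL// => kl.
  have kn : (i.+1 + k < n.+1)%N by rewrite ltnS (leq_trans kl (leq_trans lm mn)).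
  apply: random_element_cylinder; apply: JX; rewrite inordK// ltn_addr//=.
  exact: leq_trans kl lm.
rewrite (_ : [set _ | _] = Z @^-1` [set y | b < mdist z0 (z0 * y)%g]).
  exact: (mZ _ (borel_open (open_translated_mdist_gt z0 z0 b))).
apply/funext => w; rewrite /= -(subnKC il) addSnnS (gap_blockE z0)//.
Qed.

Lemma measurable_level (J : {set 'I_n.+1}) t j : (j <= n)%N ->
  (forall k : 'I_n.+1, (k <= j)%N -> k \in J) ->
  <<s cylinder X J >> [set w | t < level z0 z1 X j w].
Proof.
move=> jn JX; pose TJ := g_sigma_algebraType (cylinder X J).
pose Z (w : TJ) := partial_product X j w.
have mZ : random_element Z.
  apply: random_element_prefix_prod => k kj.
  by apply: random_element_cylinder; apply: JX; rewrite inordK// ltnS (leq_trans kj).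
exact: (mZ _ (borel_open (open_translated_mdist_gt z0 z1 t))).
Qed.

Lemma measurable_hits (J : {set 'I_n.+1}) t m : (m <= n.+1)%N ->
  (forall k : 'I_n.+1, (k < m)%N -> k \in J) ->
  <<s cylinder X J >> (hits z0 z1 X t m).
Proof.
move=> mn JX; pose TJ := g_sigma_algebraType (cylinder X J).
suff : measurable (hits z0 z1 X t m : set TJ) by [].
rewrite (_ : hits z0 z1 X t m =
  \bigcup_(j in [set j | (j < m)%N]) [set w | t < level z0 z1 X j w])//.
apply: bigcup_measurable => j /= jm.
apply: measurable_level => [|k kj]; first by rewrite -ltnS (leq_trans jm).
by apply: JX; exact: leq_ltn_trans jm.
Qed.

Lemma measurable_chain (J : {set 'I_n.+1}) b k i :
  (forall j : 'I_n.+1, (i < j)%N -> j \in J) ->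
  <<s cylinder X J >> (chain X b k i).
Proof.
pose TJ := g_sigma_algebraType (cylinder X J).
elim: k i => [|k IH] i JX; first exact: (@measurableT _ TJ).
suff : measurable (chain X b k.+1 i : set TJ) by [].
rewrite (_ : chain X b k.+1 i = \bigcup_(l in [set l | (i <= l < n)%N])
  ((exceeds X b i l.+1 `\` exceeds X b i l) `&` chain X b k l.+1))//.
apply: bigcup_measurable => l /= /andP[il ln]; apply: measurableI; last first.
  by apply: IH => j lj; apply: JX; rewrite (leq_ltn_trans il)// ltnW.
by apply: measurableD; apply: measurable_exceeds => //;
  first [exact: ltnW | move=> j /andP[ij _]; exact: JX].
Qed.

End measurability.

(** * Tail inequalities *)

Section tails.
Context (R : realType) (G : metricSemigroupType R) (z0 z1 : G).
Context d (T : measurableType d) (P : probability T R).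
Context (n : nat) (X : 'I_n.+1 -> T -> G).
Hypothesis sepG : separable G.
Hypotheses (mX : forall i, random_element (X i)) (indX : independent P X).

Local Lemma sigma_measurable (J : {set 'I_n.+1}) (A : set T) :
  <<s cylinder X J >> A -> measurable A.
Proof.
apply: smallest_sub; first exact: sigma_algebra_measurable.
exact: cylinder_measurable.
Qed.

Local Lemma sigma_setC (J : {set 'I_n.+1}) (A : set T) :
  <<s cylinder X J >> A -> <<s cylinder X J >> (~` A).
Proof.
move=> sA; exact: (@measurableC _ (g_sigma_algebraType (cylinder X J))).
Qed.

Local Lemma sigma_setD (J : {set 'I_n.+1}) (A B : set T) :
  <<s cylinder X J >> A -> <<s cylinder X J >> B -> <<s cylinder X J >> (A `\` B).
Proof.
move=> sA sB; exact: (@measurableD _ (g_sigma_algebraType (cylinder X J))).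
Qed.

Local Lemma pr_before_after i (A B : set T) :
  <<s cylinder X (before n i) >> A -> <<s cylinder X (after n i) >> B ->
  pr P (A `&` B) = pr P A * pr P B.
Proof.
move=> sA sB; rewrite /pr (independent_sigma_algebra mX indX _ sA sB).
  have mA := sigma_measurable sA; have mB := sigma_measurable sB.
  by rewrite fineM// fin_num_measure.
by move=> j; rewrite !inE -leqNgt.
Qed.

Local Lemma sigma_exceeds b i m : (m <= n)%N ->
  <<s cylinder X (after n i) >> (exceeds X b i m).
Proof.
by move=> mn; apply: measurable_exceeds => // j /andP[ij _]; rewrite inE.
Qed.

Local Lemma sigma_exceeds_before b i m : (m <= n)%N ->
  <<s cylinder X (before n m) >> (exceeds X b i m).
Proof.
by move=> mn; apply: measurable_exceeds => // j /andP[_ jm]; rewrite inE.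
Qed.

Local Lemma sigma_hits t m : (m <= n)%N ->
  <<s cylinder X (before n m) >> (hits z0 z1 X t m.+1).
Proof. by move=> mn; apply: measurable_hits => // j jm; rewrite inE. Qed.

Local Lemma sigma_hits' t m : (m <= n)%N ->
  <<s cylinder X (before n m) >> (hits z0 z1 X t m).
Proof.
by move=> mn; apply: measurable_hits => // [|j jm]; rewrite ?inE ltnW.
Qed.

Local Lemma sigma_chain b k i : <<s cylinder X (after n i) >> (chain X b k i).
Proof. by apply: measurable_chain => // j ij; rewrite inE. Qed.

Local Lemma m_exceeds b i m : (m <= n)%N -> measurable (exceeds X b i m).
Proof. by move=> mn; exact: (sigma_measurable (@sigma_exceeds b i m mn)). Qed.

Local Lemma m_hits t m : (m <= n.+1)%N -> measurable (hits z0 z1 X t m).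
Proof.
move=> mn; apply: (@sigma_measurable (before n n)).
by apply: measurable_hits => // j _; rewrite inE -ltnS ltn_ord.
Qed.

Local Lemma m_chain b k i : measurable (chain X b k i).
Proof. exact: (sigma_measurable (@sigma_chain b k i)). Qed.

Let h t m := pr P (hits z0 z1 X t m).

Local Lemma h_le t m m' : (m <= m' <= n.+1)%N -> h t m <= h t m'.
Proof.
move=> /andP[mm' m'n]; apply: pr_le; last exact: hits_le.
  exact: m_hits (leq_trans mm' m'n).
exact: m_hits.
Qed.

(** Staying at distance at most a from z1 up to time i is independent of an
    exceedance between i and m, and when both happen the distance a is exceeded
    for the first time between i and m. *)
Lemma pr_exceeds_le a i m : (i <= m <= n)%N ->
  (1 - h a i.+1) * pr P (exceeds X (a + a) i m) <= h a m.+1 - h a i.+1.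
Proof.
move=> /andP[im mn]; have ni := leq_trans im mn.
rewrite -prC; last exact: m_hits.
rewrite -(pr_before_after (i := i)); last 2 first.
- by apply: sigma_setC; apply: sigma_hits.
- exact: sigma_exceeds.
rewrite -prD; [|exact: m_hits..|exact: hits_le].
rewrite setIC -setDE; apply: pr_le.
- by apply: measurableD; [exact: m_exceeds|exact: m_hits].
- by apply: measurableD; exact: m_hits.
- exact: exceeds_sub_hitsD.
Qed.

(** Conditioning on the first time of the chain: by [pr_exceeds_le] its
    distribution function is at most lam i - lam m, where lam does not depend on
    i, and the rest of the chain is estimated by a power of lam at that time. *)
Lemma pr_chain_le a k i : (i <= n)%N -> h a n.+1 < 1 ->
  pr P (chain X (a + a) k i) <=
  ((h a n.+1 - h a i.+1) / (1 - h a n.+1)) ^+ k / k`!%:R.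
Proof.
move=> + hn1; have hn0 : 0 < 1 - h a n.+1 by rewrite subr_gt0.
elim: k i => [|k IH] i ni.
  by rewrite expr0 fact0 invr1 mulr1 pr_le1//; exact: m_chain.
pose lam m := (h a n.+1 - h a m.+1) / (1 - h a n.+1).
pose e m := pr P (exceeds X (a + a) i m).
have lam0 m : (m <= n)%N -> 0 <= lam m.
  by move=> mn; rewrite /lam divr_ge0 ?subr_ge0 ?h_le ?ltW// ltnS mn leqnn.
have exS l : exceeds X (a + a) i l `<=` exceeds X (a + a) i l.+1.
  exact: exceedsS.
have fem l : (i <= l < n)%N ->
    measurable (exceeds X (a + a) i l.+1 `\` exceeds X (a + a) i l).
  by move=> /andP[_ ln]; apply: measurableD; apply: m_exceeds => //; exact: ltnW.
apply: (@le_trans _ _ (\sum_(i <= l < n) (e l.+1 - e l) * lam l.+1 ^+ k / k`!%:R)).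
  rewrite /=; apply: le_trans (pr_exists_le _ _) _ => [l iln|].
    by apply: measurableI; [exact: fem|exact: m_chain].
  apply: ler_sum_nat => l iln; have /andP[il ln] := iln.
  rewrite (pr_before_after (i := l.+1)); last 2 first.
  - by apply: sigma_setD; [exact: sigma_exceeds_before|];
      apply: measurable_exceeds => // [|j /andP[_ jl]]; rewrite ?inE ltnW.
  - exact: sigma_chain.
  rewrite prD; [|exact: m_exceeds|exact: m_exceeds (ltnW ln)|exact: exS].
  rewrite -mulrA ler_wpM2l ?subr_ge0 ?pr_le//; last exact: IH.
    exact: m_exceeds (ltnW ln).
  exact: m_exceeds.
rewrite -mulr_suml factS natrM invfM mulrA ler_wpM2r ?invr_ge0 ?ler0n//.
apply: (@sum_increments_expr_le _ e lam (lam i)) => //.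
- rewrite /e /pr (_ : exceeds _ _ _ _ = set0) ?measure0//.
  apply/seteqP; split => // w [l /andP[il li]].
  by move: (leq_ltn_trans li il); rewrite ltnn.
- move=> m /andP[im mn]; apply: pr_le => //; last exact: m_exceeds.
  exact: m_exceeds (ltnW mn).
- move=> m imn; have /andP[im mn] := imn; rewrite lam0//=.
  have hin : h a i.+1 <= h a n.+1 by apply: h_le; rewrite ltnS ni leqnn.
  have := pr_exceeds_le a imn; rewrite -/(e m) => hem.
  rewrite lerBrDl -lerBrDr /lam -mulrBl ler_pdivlMr//.
  have e0 : 0 <= e m := pr_ge0 _ _.
  apply: (@le_trans _ _ (h a m.+1 - h a i.+1)); last lra.
  by apply: le_trans hem; rewrite mulrC ler_wpM2r// lerD2l lerN2.
Qed.

Let U := max_partial_dist z0 z1 X.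
Let M := max_step_dist z0 X.

Lemma max_partial_dist_gtE t : 0 <= t ->
  [set w | t < U w] = hits z0 z1 X t n.+1.
Proof.
move=> t0; apply/seteqP; split => w /=.
  move=> /bigmax_gtP[|[i _ ti]]; first by rewrite ltNge t0.
  by exists i => //; exact: ltn_ord.
move=> [j jn tj]; apply/bigmax_gtP; right.
by exists (Ordinal jn).
Qed.

Lemma max_step_dist_ge w i : mdist z0 (z0 * X i w)%g <= M w.
Proof. exact: le_bigmax. Qed.

Lemma measurable_bigmax0 (F : 'I_n.+1 -> T -> R) :
  (forall i t, measurable [set w | t < F i w]) ->
  measurable_fun setT (fun w => \big[Num.max/0]_(i < n.+1) F i w).
Proof.
move=> mF _; apply: (measurability _ (RGenOInfty.measurableE R)) => //.
move=> _ [_ [t ->] <-]; rewrite setTI.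
rewrite (_ : _ @^-1` _ =
  [set w | t < 0] `|` \bigcup_(i in setT) [set w | t < F i w]).
  apply: measurableU; last by apply: fin_bigcup_measurable.
  have [t0|t0] := ltP t 0.
    by rewrite (_ : [set _ | _] = setT)//; apply/seteqP; split.
  by rewrite (_ : [set _ | _] = set0)//; apply/seteqP; split => // w /=.
apply/seteqP; split => w /=; rewrite in_itv/= andbT.
  by move=> /bigmax_gtP[?|[i _ ti]]; [left|right; exists i].
by move=> [?|[i _ ti]]; apply/bigmax_gtP; [left|right; exists i].
Qed.

Lemma measurable_max_partial_dist : measurable_fun setT U.
Proof.
apply: measurable_bigmax0 => i t.
apply: (@sigma_measurable (before n i)).
by apply: measurable_level => // [|k]; rewrite ?inE// -ltnS.
Qed.

Lemma measurable_max_step_dist : measurable_fun setT M.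
Proof.
apply: measurable_bigmax0 => i t.
exact: (mX i (borel_open (open_translated_mdist_gt z0 z0 t))).
Qed.

Lemma measurable_gt (f : T -> R) t : measurable_fun setT f ->
  measurable [set w | t < f w].
Proof.
move=> mf; have := measurable_fun_ltr (measurable_cst t) mf.
by move=> /(_ measurableT [set true] I); rewrite setTI.
Qed.

Lemma level0_le w : level z0 z1 X 0 w <= mdist z1 z0 + M w.
Proof.
rewrite /level /partial_product/= (le_trans (metric_triangle _ z0 _))// lerD2l.
exact: max_step_dist_ge.
Qed.

Lemma gap_step_le w j : (j < n)%N -> gap X j j.+1 w <= M w.
Proof. by move=> jn; rewrite (gap_stepE z0)//; exact: max_step_dist_ge. Qed.

(** When all steps are at most s and no chain of k exceedances starts from the
    first partial product, [gap_le_not_chain] keeps the whole path within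
    (a + s) + s + k (2a + s) of z1. *)
Lemma pr_max_gt_chain a s k : 0 <= a -> 0 <= s -> mdist z1 z0 <= a + s ->
  pr P [set w | a < U w] < 1 ->
  pr P [set w | 2 * k.+1%:R * (a + s) < U w] <=
  pr P [set w | s < M w] +
  (pr P [set w | a < U w] / (1 - pr P [set w | a < U w])) ^+ k / k`!%:R.
Proof.
move=> a0 s0 das; rewrite (max_partial_dist_gtE a0) => h1.
have as0 : 0 <= 2 * k.+1%:R * (a + s) by rewrite !mulr_ge0// addr_ge0.
rewrite max_partial_dist_gtE//.
have mM := measurable_gt s measurable_max_step_dist.
apply: le_trans (lerD (lexx _) (_ : pr P (chain X (a + a) k 0) <= _));
  last first.
  apply: le_trans (pr_chain_le _ _ h1) _ => //.
  rewrite ler_wpM2r ?invr_ge0 ?ler0n//; apply: lerXn2r; rewrite ?nnegrE.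
  - apply: divr_ge0; rewrite subr_ge0; last exact: ltW.
    by apply: h_le; rewrite /= leqnn.
  - by apply: divr_ge0; rewrite ?pr_ge0// subr_ge0 ltW.
  - apply: ler_wpM2r; first by rewrite invr_ge0 subr_ge0 ltW.
    by rewrite lerBlDr lerDl pr_ge0.
apply: le_trans (prU_le P mM (m_chain _ _ _)).
apply: pr_le; [exact: m_hits|by apply: measurableU => //; exact: m_chain|].
move=> w [l ln asl]; have [sM|Ms] := ltP s (M w); [by left|right].
apply: contrapT => nch.
have stepw j : (j < n)%N -> gap X j j.+1 w <= s.
  by move=> jn; exact: le_trans (gap_step_le w jn) Ms.
have gl := gap_le_not_chain (addr_ge0 a0 a0) s0 stepw nch (ln : (0 <= l <= n)%N).
have := level_le_gap z0 z1 X 0 l w; have := level0_le w.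
have : 0 <= k%:R * s by rewrite mulr_ge0.
move: gl asl das Ms a0; rewrite -[k.+1%:R]natr1; lra.
Qed.

(** With steps at most s, the first distance above t is at most t + s; to exceed
    t + 2 t0 + s the path has to move by more than 2 t0 afterwards, which is
    independent of that time and forces U > t0. *)
Lemma pr_max_gt_two_blocks t t0 s : 0 <= t -> 0 <= t0 -> 0 <= s ->
  mdist z1 z0 <= t ->
  pr P [set w | t + (t0 + t0) + s < U w] <=
  pr P [set w | s < M w] + pr P [set w | t < U w] * pr P [set w | t0 < U w].
Proof.
move=> tge0 t00 s0 dt.
have mM := measurable_gt s measurable_max_step_dist.
pose A l := (hits z0 z1 X t l.+1 `\` hits z0 z1 X t l) `&`
            exceeds X (t0 + t0) l n.
have sF l : (l <= n)%N -> <<s cylinder X (before n l) >>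
    (hits z0 z1 X t l.+1 `\` hits z0 z1 X t l).
  by move=> ln; apply: sigma_setD; [apply: sigma_hits|apply: sigma_hits'].
have mA l : (0 <= l < n.+1)%N -> measurable (A l).
  move=> ln; apply: measurableI; first exact: sigma_measurable (sF _ ln).
  exact: m_exceeds.
have mE : measurable [set w | exists2 l, (0 <= l < n.+1)%N & A l w].
  rewrite (_ : [set _ | _] = \bigcup_(l in [set l | (0 <= l < n.+1)%N]) A l)//.
  by apply: bigcup_measurable => l; exact: mA.
rewrite !max_partial_dist_gtE ?addr_ge0//.
apply: le_trans (lerD (lexx _) (_ : pr P
    [set w | exists2 l, (0 <= l < n.+1)%N & A l w] <= _)); last first.
  apply: le_trans (pr_exists_le _ mA) _.
  apply: (@le_trans _ _ (\sum_(0 <= l < n.+1) (h t l.+1 - h t l) * h t0 n.+1)).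
    apply: ler_sum_nat => l ln; rewrite (pr_before_after (i := l)); last 2 first.
    - exact: sF.
    - exact: sigma_exceeds.
    rewrite prD; [|exact: m_hits|exact: m_hits (ltnW ln)|exact: hits_le].
    rewrite ler_wpM2l ?subr_ge0 ?h_le ?leqnSn//.
    apply: pr_le; [exact: m_exceeds|exact: m_hits|exact: exceeds_sub_hits].
  rewrite -mulr_suml telescope_sumr// ler_wpM2r ?pr_ge0//.
  by rewrite lerBlDr lerDl pr_ge0.
apply: le_trans (prU_le P mM mE).
apply: pr_le; [exact: m_hits|exact: measurableU|].
move=> w [m mn tm]; have [sM|Ms] := ltP s (M w); [by left|right].
have hm : hits z0 z1 X t n.+1 w by exists m => //; move: tm t00 s0; lra.
have [l ln Fl] := first_hit hm; exists l => //; split => //.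
have lvl : level z0 z1 X l w <= t + s.
  case: l ln Fl => [|l] ln [_ nh]; first by have := level0_le w; move: dt Ms; lra.
  have : level z0 z1 X l w <= t.
    by rewrite leNgt; apply/negP => tl; apply: nh; exists l.
  have := level_le_gap z0 z1 X l l.+1 w; have := gap_step_le w ln.
  move: Ms; lra.
have lm : (l < m)%N.
  rewrite ltnNge leq_eqVlt; apply/negP => /orP[/eqP ml|ml].
    by move: tm; rewrite ml; move: lvl t00; lra.
  by case: Fl => _; apply; exists m => //; move: tm t00 s0; lra.
exists m; first by rewrite lm -ltnS.
by have := level_le_gap z0 z1 X l m w; move: lvl tm; lra.
Qed.

Lemma max_partial_dist_ge0 w : 0 <= U w.
Proof. exact: bigmax_ge_id. Qed.

Lemma max_step_dist_ge0 w : 0 <= M w.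
Proof. exact: bigmax_ge_id. Qed.

Lemma mdist_le_max w : mdist z1 z0 <= U w + M w.
Proof.
apply: le_trans (metric_triangle _ (z0 * X ord0 w)%g _) _.
rewrite (metric_sym _ z0); apply: lerD; last exact: max_step_dist_ge.
have := le_bigmax (0 : R) (fun i => mdist z1 (z0 * partial_prod X i w)%g) ord0.
rewrite {1}/partial_prod/= (_ : inord 0 = ord0)//.
by apply/val_inj; rewrite /= inordK.
Qed.

(** Crude, since it grows with n, but it shows that U has the moments of M. *)
Lemma max_partial_dist_le w : U w <= mdist z1 z0 + n.+1%:R * M w.
Proof.
have lev j : (j < n.+1)%N -> level z0 z1 X j w <= mdist z1 z0 + j.+1%:R * M w.
  elim: j => [_|j IH jn]; first by rewrite mul1r; exact: level0_le.
  have := level_le_gap z0 z1 X j j.+1 w; have := gap_step_le w jn.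
  have := IH (ltnW jn); rewrite -[j.+2%:R]natr1; lra.
have M0 := max_step_dist_ge0 w.
apply/bigmax_leP; split => [|i _]; first by rewrite addr_ge0 ?mulr_ge0 ?mdist_ge0.
apply: le_trans (lev i (ltn_ord i)) _.
by rewrite lerD2l ler_wpM2r// ler_nat.
Qed.

End tails.

(** * Moments and rearrangements *)

Lemma powR_invK (R : realType) (x r : R) : 0 <= x -> r != 0 ->
  (x `^ r^-1) `^ r = x.
Proof. by move=> x0 r0; rewrite -powRrM mulVf// powRr1. Qed.

Lemma powRK_inv (R : realType) (x r : R) : 0 <= x -> r != 0 ->
  (x `^ r) `^ r^-1 = x.
Proof. by move=> x0 r0; rewrite -powRrM mulfV// powRr1. Qed.

Lemma lt_powR_iff (R : realType) (u x q : R) : 0 <= u -> 0 <= x -> 0 < q ->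
  (u < x `^ q) = (u `^ q^-1 < x).
Proof.
move=> u0 x0 q0; apply/idP/idP => [ux|ux].
  rewrite -[ltRHS](powRK_inv x0 (lt0r_neq0 q0)).
  by apply: gt0_ltr_powR; rewrite ?invr_gt0 ?nnegrE ?powR_ge0.
rewrite -[ltLHS](powR_invK u0 (lt0r_neq0 q0)).
by apply: gt0_ltr_powR; rewrite ?nnegrE ?powR_ge0.
Qed.

Lemma le_powR_iff (R : realType) (x y q : R) : 0 <= x -> 0 <= y -> 0 < q ->
  (x `^ q <= y `^ q) = (x <= y).
Proof.
move=> x0 y0 q0; apply/idP/idP => [|xy]; last first.
  by apply: ge0_ler_powR; rewrite ?nnegrE//; exact: ltW.
rewrite !leNgt; apply: contraNN => yx.
by apply: gt0_ltr_powR; rewrite ?nnegrE.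
Qed.

Section moments.
Context d (T : measurableType d) (R : realType) (P : probability T R).
Implicit Types X Y Z : T -> R.

Lemma ge0_expectationZl X (k : R) : measurable_fun setT X -> (forall w, 0 <= X w) ->
  0 <= k -> ('E_P[fun w => (k * X w)%R] = k%:E * 'E_P[X])%E.
Proof.
move=> mX X0 k0; rewrite unlock.
under eq_integral do rewrite EFinM.
rewrite ge0_integralZl//=; first exact/measurable_EFinP.
by move=> w _; rewrite lee_fin.
Qed.

Lemma expectation_ccdf X : measurable_fun setT X -> (forall w, 0 <= X w) ->
  ('E_P[X] = \int[lebesgue_measure]_(r in `[0%R, +oo[)
               (pr P [set w | (r < X w)%R])%:E)%E
  /\ measurable_fun setT (fun r : R => (pr P [set w | r < X w])%:E).
Proof.
move=> mX X0.
pose X' : {RV P >-> R} := HB.pack X (isMeasurableFun.Build _ _ _ _ X mX).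
have ccdfE r : ccdf (P := P) X' r = (pr P [set w | r < X w])%:E.
  rewrite EFin_pr; last exact: measurable_gt.
  rewrite /ccdf /distribution /pushforward; congr (P _).
  by apply/seteqP; split => w /=; rewrite in_itv/= andbT.
split; last first.
  by rewrite -(funext ccdfE); exact: ccdf_measurable.
rewrite -[LHS]/(expectation P X') ge0_expectation_ccdf//.
by apply: eq_integral => r _; rewrite ccdfE.
Qed.

(** Layer-cake comparison: below u0 the probability is estimated by 1, the
    tail of the constant u0. *)
Lemma expectation_le_of_tails X Y Z (u0 delta : R) :
  measurable_fun setT X -> measurable_fun setT Y -> measurable_fun setT Z ->
  (forall w, 0 <= X w) -> (forall w, 0 <= Y w) -> (forall w, 0 <= Z w) ->
  0 <= u0 -> 0 <= delta ->
  (forall u, u0 <= u -> pr P [set w | u < X w] <=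
     delta * pr P [set w | u < Y w] + pr P [set w | u < Z w]) ->
  ('E_P[X] <= u0%:E + delta%:E * 'E_P[Y] + 'E_P[Z])%E.
Proof.
move=> mX mY mZ X0 Y0 Z0 u00 d0 H.
have [-> mPX] := expectation_ccdf mX X0.
have [-> mPY] := expectation_ccdf mY Y0.
have [-> mPZ] := expectation_ccdf mZ Z0.
have mc : measurable_fun setT (fun _ : T => u0) by exact: measurable_cst.
rewrite -[u0%:E](expectation_cst P).
have [-> mPc] := expectation_ccdf mc (fun=> u00).
have mP V (f : R -> \bar R) : measurable_fun setT f -> measurable_fun V f.
  exact: measurable_funTS.
rewrite -ge0_integralZl//=; last 2 first.
- exact: mP.
- by move=> r _; rewrite lee_fin pr_ge0.
rewrite -ge0_integralD//=; last 4 first.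
- by move=> r _; rewrite lee_fin pr_ge0.
- exact: mP.
- by move=> r _; rewrite mule_ge0 ?lee_fin ?pr_ge0.
- by apply: mP; exact: measurable_funeM.
rewrite -ge0_integralD//=; last 4 first.
- by move=> r _; rewrite adde_ge0 ?mule_ge0 ?lee_fin ?pr_ge0.
- by apply: mP; apply: emeasurable_funD => //; exact: measurable_funeM.
- by move=> r _; rewrite lee_fin pr_ge0.
- exact: mP.
apply: ge0_le_integral => //=.
- by move=> r _; rewrite lee_fin pr_ge0.
- exact: mP.
- apply: mP; apply: emeasurable_funD => //.
  by apply: emeasurable_funD => //; exact: measurable_funeM.
move=> u _; rewrite -EFinM -!EFinD lee_fin.
have [u0u|uu0] := leP u0 u.
  by apply: le_trans (H u u0u) _; rewrite -addrA lerDr pr_ge0.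
apply: le_trans (pr_le1 P (measurable_gt u mX)) _.
rewrite -addrA ler_wpDr ?addr_ge0 ?mulr_ge0 ?pr_ge0//.
rewrite (_ : [set _ | _] = setT) /pr ?probability_setT//.
by apply/seteqP; split.
Qed.

Lemma measurable_powR_fun X (q : R) : measurable_fun setT X ->
  measurable_fun setT (fun w => X w `^ q).
Proof. by move=> mX; exact: measurableT_comp (measurable_powR q) mX. Qed.

Lemma moment_root_fin X (q m : R) : 0 < q -> moment_root P X q = m%:E ->
  'E_P[fun w => (X w `^ q)%R]%E = (m `^ q)%:E.
Proof.
rewrite /moment_root => q0.
have : (0 <= 'E_P[fun w => (X w `^ q)%R])%E.
  by apply: expectation_ge0 => w; exact: powR_ge0.
case: ('E_P[_]%E) => [e|_|//]; last first.
  by rewrite /= invr_eq0 gt_eqF.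
rewrite lee_fin/= => e0 [<-].
by rewrite powR_invK// gt_eqF.
Qed.

Lemma moment_root_le X (q B : R) : 0 < q -> 0 <= B ->
  ('E_P[fun w => (X w `^ q)%R] <= (B `^ q)%:E)%E -> (moment_root P X q <= B%:E)%E.
Proof.
rewrite /moment_root => q0 B0.
have : (0 <= 'E_P[fun w => (X w `^ q)%R])%E.
  by apply: expectation_ge0 => w; exact: powR_ge0.
case: ('E_P[_]%E) => [e|_|//]; last by rewrite leye_eq.
rewrite !lee_fin/= => e0 eB; rewrite ?lee_fin -[leRHS](powRK_inv B0 (lt0r_neq0 q0)).
by apply: ge0_ler_powR; rewrite ?invr_ge0 ?nnegrE ?powR_ge0//; exact: ltW.
Qed.

Lemma chebyshev_moment X (a p u : R) : measurable_fun setT X ->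
  (forall w, 0 <= X w) -> 0 < a -> 0 < p -> moment_root P X p = u%:E ->
  pr P [set w | a < X w] * a `^ p <= u `^ p.
Proof.
move=> mX X0 a0 p0 /(moment_root_fin p0) EX.
pose X' : {RV P >-> R} := HB.pack X (isMeasurableFun.Build _ _ _ _ X mX).
have := @markov _ _ _ P X' (fun x => x `^ p) a a0 (measurable_powR p).
move=> /(_ (fun r _ => powR_ge0 r p)).
have homo : {in Num.nneg &, {homo (fun x : R => x `^ p) : x y / x <= y}}.
  by apply: ge0_ler_powR; exact: ltW.
move=> /(_ homo).
have -> : 'E_P[((fun x : R => (x `^ p)%R) \o [eta Num.Def.normr]) \o X']%E =
          'E_P[fun w => (X w `^ p)%R]%E.
  by congr expectation; apply/funext => w /=; rewrite ger0_norm//; exact: X0.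
rewrite EX => H; rewrite -lee_fin; apply: le_trans H.
rewrite mulrC EFinM; apply: lee_wpmul2l; first by rewrite lee_fin powR_ge0.
rewrite EFin_pr; last exact: measurable_gt.
have mge : measurable [set w | a <= X w].
  have := measurable_fun_ler (measurable_cst a) mX.
  by move=> /(_ measurableT [set true] I); rewrite setTI.
have -> : [set w | (a%:E <= `|(X' w)%:E|)%E] = [set w | a <= X w].
  apply/seteqP; split => w /=; rewrite lee_fin ger0_norm//; exact: X0.
by apply: le_measure; rewrite ?inE//; [exact: measurable_gt|move=> w /= /ltW].
Qed.

Lemma decreasing_rearrangement_ge0 X t : (0 <= decreasing_rearrangement P X t)%E.
Proof. by rewrite /decreasing_rearrangement le_max lexx. Qed.

(** The slack eta puts the level strictly above the supremum that defines the
    rearrangement, so that no right-continuity of the tail is needed. *)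
Lemma pr_gt_rearrangement X (t m eta : R) : measurable_fun setT X ->
  decreasing_rearrangement P X t = m%:E -> 0 < eta ->
  pr P [set w | m + eta < X w] <= t.
Proof.
move=> mX Xm eta0; rewrite leNgt; apply/negP => tm.
have m0 : 0 <= m by rewrite -lee_fin -Xm decreasing_rearrangement_ge0.
have : ((m + eta)%:E <= decreasing_rearrangement P X t)%E.
  rewrite /decreasing_rearrangement le_max; apply/orP; right.
  apply: ereal_sup_ubound; exists (m + eta) => //.
  split; first by rewrite addr_ge0// ltW.
  by rewrite -EFin_pr ?lte_fin//; exact: measurable_gt.
by rewrite Xm lee_fin gerDl leNgt eta0.
Qed.

Lemma decreasing_rearrangement_le X (t B : R) : measurable_fun setT X -> 0 <= B ->
  (forall y, 0 < y -> t < pr P [set w | y < X w] -> y <= B) ->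
  (decreasing_rearrangement P X t <= B%:E)%E.
Proof.
move=> mX B0 H; rewrite /decreasing_rearrangement ge_max lee_fin B0/=.
apply: ge_ereal_sup => _ [y [y0 ty] <-]; rewrite lee_fin.
move: y0; rewrite le_eqVlt => /predU1P[<-//|y0]; apply: H => //.
by rewrite -lte_fin EFin_pr//; exact: measurable_gt.
Qed.

End moments.

(** * Numerical constants *)

(** y ^+ k / k! is one of the terms of the series of expR y. *)
Lemma invr_fact_le (R : realType) (y : R) k : 0 < y ->
  k`!%:R^-1 <= expR (y - k%:R * ln y).
Proof.
move=> y0; rewrite expRB expRM_natl lnK ?posrE// ler_pdivlMr ?exprn_gt0//.
case: k => [|k]; first by rewrite fact0 invr1 mul1r expr0 -expR0 ler_expR ltW.
rewrite mulrC; apply: le_trans (expR_ge1Dxn k (ltW y0)).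
by rewrite lerDr.
Qed.

Lemma powR_ge1 (R : realType) (a x : R) : 1 <= a -> 0 <= x -> 1 <= a `^ x.
Proof. by move=> a1 x0; rewrite -(powRr0 a); exact: ler_powR. Qed.

Section constants.
Context (R : realType) (p0 : R) (hp0 : 0 < p0).

(** Chosen so that q + ln 16 <= block_constant * q for all q >= p0. *)
Definition block_constant : R := 1 + ln 16 / p0.

(** The number of blocks, in units of q / max (p, ln (q + ln 16)): the terms pay
    for exp (- q), for the factor 1 / 4 and for the factor exp (q + ln 16) that
    [invr_fact_le] gives for y = q + ln 16. *)
Definition chain_constant : R := 1 + ln 4 / p0 + block_constant.

(** Its p-th power is at least 2 exp p for all p >= p0. *)
Definition level_constant : R := expR 1 * 2 `^ p0^-1.

(** With K = q / max (p, ln (q + ln 16)), the level t0 is at most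
    2 (chain_constant + 2 block_constant) level_constant K times the sum of the
    moment root of U and of the rearrangement of M, where 2 block_constant
    accounts for the rounding of the number of blocks; absorbing the top moment
    costs another factor 8 * 4 ^ (1 / p0). *)
Definition theorem_constant : R :=
  4 `^ p0^-1 * (16 * ((chain_constant + 2 * block_constant) * level_constant)).

Let ln4_ge0 : 0 <= ln 4 :> R. Proof. by rewrite ln_ge0// ler1n. Qed.
Let ln16_ge0 : 0 <= ln 16 :> R. Proof. by rewrite ln_ge0// ler1n. Qed.

Lemma block_constant_ge1 : 1 <= block_constant.
Proof. by rewrite lerDl divr_ge0// ltW. Qed.

Lemma chain_constant_ge1 : 1 <= chain_constant.
Proof.
rewrite /chain_constant -addrA lerDl addr_ge0// ?divr_ge0// 1?ltW//.
exact: lt_le_trans block_constant_ge1.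
Qed.

Lemma level_constant_ge1 : 1 <= level_constant.
Proof.
rewrite /level_constant -[leLHS]mulr1 ler_pM//.
  by rewrite -expR0 ler_expR.
by rewrite powR_ge1 ?ler1n// invr_ge0 ltW.
Qed.

Lemma powR4_ge1 : 1 <= 4 `^ p0^-1 :> R.
Proof. by rewrite powR_ge1 ?ler1n// invr_ge0 ltW. Qed.

Lemma theorem_constant_ge : 4 * 4 `^ p0^-1 <= theorem_constant.
Proof.
rewrite /theorem_constant mulrC; apply: ler_wpM2l; first exact: powR_ge0.
have h : 1 <= (chain_constant + 2 * block_constant) * level_constant.
  rewrite -[leLHS]mulr1 ler_pM ?level_constant_ge1//.
  have := chain_constant_ge1; have := block_constant_ge1; lra.
lra.
Qed.

Lemma theorem_constant_gt0 : 0 < theorem_constant.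
Proof. by apply: lt_le_trans theorem_constant_ge; have := powR4_ge1; lra. Qed.

Lemma add_ln16_le q : p0 <= q -> q + ln 16 <= block_constant * q.
Proof.
move=> pq; rewrite /block_constant mulrDl mul1r lerD2l -mulrA ler_peMr//.
by rewrite mulrC ler_pdivlMr// mul1r.
Qed.

Lemma max_ln_le p q : p0 <= p -> p <= q ->
  Num.max p (ln (q + ln 16)) <= block_constant * q.
Proof.
move=> p0p pq; have q0 : 0 < q by apply: lt_le_trans hp0 (le_trans p0p pq).
have y0 : 0 < q + ln 16 by rewrite ltr_wpDr.
rewrite ge_max; apply/andP; split.
  by apply: le_trans pq _; rewrite ler_peMl ?block_constant_ge1// ltW.
apply: le_trans (add_ln16_le (le_trans p0p pq)).
by rewrite ltW// ln_sublinear.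
Qed.

(** Either p is the larger term and exp (- p k) alone is small enough, or
    L = ln (q + ln 16) is, and then [invr_fact_le] bounds 1 / k! by
    exp (q + ln 16 - k L). *)
Lemma chain_bound_le p q k : p0 <= p -> p <= q ->
  chain_constant * (q / Num.max p (ln (q + ln 16))) <= k%:R ->
  expR (- p) ^+ k / k`!%:R <= expR (- q) / 4.
Proof.
move=> p0p pq hk; have p_gt0 : 0 < p by exact: lt_le_trans p0p.
have q0 : 0 < q by exact: lt_le_trans pq.
have y0 : 0 < q + ln 16 by rewrite ltr_wpDr.
have q4 : q + ln 4 <= (1 + ln 4 / p0) * q.
  rewrite mulrDl mul1r lerD2l -mulrA ler_peMr//.
  by rewrite mulrC ler_pdivlMr// mul1r (le_trans p0p).
have hq := add_ln16_le (le_trans p0p pq).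
have B1 := block_constant_ge1.
rewrite -[4 in leRHS](@lnK R) ?posrE// -expRB -expRM_natl.
have Lq : chain_constant * q <= k%:R * Num.max p (ln (q + ln 16)).
  rewrite -ler_pdivrMr; first by rewrite -mulrA.
  by rewrite lt_max p_gt0.
have [Lp|pL] := leP (ln (q + ln 16)) p.
  move: Lq; rewrite max_l// => Lq.
  apply: (@le_trans _ _ (expR (k%:R * - p))).
    by rewrite ler_piMr ?expR_ge0// invf_le1 ?ler1n ?fact_gt0// ltr0n fact_gt0.
  rewrite ler_expR; move: Lq q4; rewrite /chain_constant.
  have : 0 <= block_constant * q by rewrite mulr_ge0 ?(le_trans _ B1)// ltW.
  rewrite !mulrDl; lra.
move: Lq; rewrite max_r; last exact: ltW.
move=> Lq.
apply: (@le_trans _ _ (k`!%:R^-1)).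
  by rewrite ler_piMl ?invr_ge0// -expR0 ler_expR mulrN oppr_le0 mulr_ge0// ltW.
apply: le_trans (invr_fact_le k y0) _.
rewrite ler_expR; move: Lq q4 hq; rewrite /chain_constant !mulrDl; lra.
Qed.

(** If eps <= 1 then ln (eps + q) <= q; otherwise ln (eps + x) is concave in x and
    nonnegative at 0, so that its quotient by x decreases from p0 to q. *)
Lemma ln_add_le eps q : p0 <= q -> 0 < eps + q ->
  ln (eps + q) <= q * Num.max 1 (ln (eps + p0) / p0).
Proof.
move=> pq eq0; have q0 : 0 < q by exact: lt_le_trans pq.
have [eps1|eps1] := leP eps 1.
  apply: (@le_trans _ _ q).
    have : ln (1 + (eps + q - 1)) <= eps + q - 1 by apply: le_ln1Dx; lra.
    rewrite [1 + _]addrC subrK; lra.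
  by rewrite ler_peMr ?le_max ?lexx// ltW.
have e0 : 0 < eps by apply: lt_trans eps1.
apply: (@le_trans _ _ (q * (ln (eps + p0) / p0))); last first.
  by rewrite ler_wpM2l ?le_max ?lexx ?orbT// ltW.
have t0 : 0 <= p0 / q by rewrite divr_ge0 ?ltW.
have t1 : p0 / q <= 1 by rewrite ler_pdivrMr// mul1r.
have := @concave_ln R (Itv01 t0 t1) (eps + q) eps eq0 e0.
rewrite !convRE /= /unstable.onem.
have -> : p0 / q * (eps + q) + (1 - p0 / q) * eps = eps + p0.
  by field; rewrite gt_eqF.
have : 0 <= (1 - p0 / q) * ln eps.
  by rewrite mulr_ge0 ?subr_ge0// ln_ge0 ?ltW.
move=> h1 h2.
have : p0 / q * ln (eps + q) <= ln (eps + p0) by lra.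
rewrite mulrAC ler_pdivrMr// mulrA ler_pdivlMr//; lra.
Qed.

End constants.

(** * Absorbing the top moment *)

Section absorption.
Context d (T : measurableType d) (R : realType) (P : probability T R).

(** Where X ^ q exceeds (2 c) ^ q, the term N * Z is more than half of X. *)
Lemma moment_lty_of_le (X Z : T -> R) (q c N m : R) :
  measurable_fun setT X -> measurable_fun setT Z ->
  (forall w, 0 <= X w) -> (forall w, 0 <= Z w) -> 0 < q -> 0 <= c -> 0 <= N ->
  (forall w, X w <= c + N * Z w) ->
  'E_P[fun w => (Z w `^ q)%R]%E = m%:E ->
  ('E_P[fun w => (X w `^ q)%R] < +oo)%E.
Proof.
move=> mX mZ X0 Z0 q0 c0 N0 XZ EZ.
pose N2 := 2 * N.
have N20 : 0 <= N2 by rewrite mulr_ge0.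
apply: (@le_lt_trans _ _ (((2 * c) `^ q)%:E + 0%:E * 'E_P[fun w => (X w `^ q)%R] +
    'E_P[fun w => (N2 `^ q * Z w `^ q)%R])%E); last first.
  rewrite ge0_expectationZl ?powR_ge0//; [|exact: measurable_powR_fun..|].
    by rewrite EZ mul0e adde0 -EFinM -EFinD ltry.
  by move=> w; exact: powR_ge0.
apply: expectation_le_of_tails; rewrite ?powR_ge0//.
- exact: measurable_powR_fun.
- exact: measurable_powR_fun.
- by apply: measurable_funM => //; exact: measurable_powR_fun.
- by move=> w; exact: powR_ge0.
- by move=> w; exact: powR_ge0.
- by move=> w; rewrite mulr_ge0// powR_ge0.
move=> u cu; rewrite mul0r add0r.
have u0 : 0 <= u by apply: le_trans cu; exact: powR_ge0.
apply: pr_le.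
- by apply: measurable_gt; exact: measurable_powR_fun.
- by apply: measurable_gt; apply: measurable_funM => //; exact: measurable_powR_fun.
move=> w /= uX; rewrite -powRM// lt_powR_iff ?mulr_ge0//.
have c2 : 2 * c <= u `^ q^-1.
  by rewrite -[leLHS](powRK_inv _ (lt0r_neq0 q0)) ?mulr_ge0//;
    apply: ge0_ler_powR; rewrite ?invr_ge0 ?nnegrE ?powR_ge0// ltW.
move: uX; rewrite lt_powR_iff// => uX.
have := XZ w; rewrite /N2; lra.
Qed.

(** The hypothesis on tails is integrated as a layer-cake comparison of
    (X / 2) ^ q with X ^ q and (2 Z) ^ q; as delta * 2 ^ q <= 1 / 2, the moment
    of X on the right, which is finite, is absorbed. *)
Lemma moment_root_le_of_halving (X Z : T -> R) (q t0 delta m : R) :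
  measurable_fun setT X -> measurable_fun setT Z ->
  (forall w, 0 <= X w) -> (forall w, 0 <= Z w) ->
  0 < q -> 0 <= t0 -> 0 <= delta -> 0 <= m -> delta * 2 `^ q <= 2^-1 ->
  'E_P[fun w => (Z w `^ q)%R]%E = (m `^ q)%:E ->
  ('E_P[fun w => (X w `^ q)%R] < +oo)%E ->
  (forall t, 4 * t0 <= t -> pr P [set w | 2 * t < X w] <=
     delta * pr P [set w | t < X w] + pr P [set w | t / 2 < Z w]) ->
  (moment_root P X q <= (4 `^ q^-1 * (2 * (4 * t0 + 2 * m)))%:E)%E.
Proof.
move=> mX mZ X0 Z0 q0 t00 d0 m0 dq EZ EX H.
have S0 : 0 <= 4 * t0 + 2 * m by rewrite addr_ge0 ?mulr_ge0.
apply: moment_root_le => //; first by rewrite !mulr_ge0 ?powR_ge0.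
have : (0 <= 'E_P[fun w => (X w `^ q)%R])%E.
  by apply: expectation_ge0 => w; exact: powR_ge0.
move: EX; case Ex : ('E_P[_]%E) => [x| |]// _; rewrite lee_fin => x0.
have : ('E_P[fun w => (2^-1 `^ q * X w `^ q)%R] <=
   ((4 * t0) `^ q)%:E + delta%:E * 'E_P[fun w => (X w `^ q)%R] +
    'E_P[fun w => (2 `^ q * Z w `^ q)%R])%E.
  apply: expectation_le_of_tails; rewrite ?powR_ge0//.
  - by apply: measurable_funM => //; exact: measurable_powR_fun.
  - exact: measurable_powR_fun.
  - by apply: measurable_funM => //; exact: measurable_powR_fun.
  - by move=> w; rewrite mulr_ge0// powR_ge0.
  - by move=> w; exact: powR_ge0.
  - by move=> w; rewrite mulr_ge0// powR_ge0.
  move=> u tu; have u0 : 0 <= u by apply: le_trans tu; exact: powR_ge0.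
  have ht : 4 * t0 <= u `^ q^-1.
    by rewrite -[leLHS](powRK_inv _ (lt0r_neq0 q0)) ?mulr_ge0//;
      apply: ge0_ler_powR; rewrite ?invr_ge0 ?nnegrE ?powR_ge0// ltW.
  have := H _ ht.
  have -> : [set w | 2 * u `^ q^-1 < X w] = [set w | u < 2^-1 `^ q * X w `^ q].
    apply/funext => w /=; rewrite -powRM// lt_powR_iff ?mulr_ge0//.
    by congr is_true; apply/idP/idP; lra.
  have -> : [set w | u `^ q^-1 < X w] = [set w | u < X w `^ q].
    by apply/funext => w /=; rewrite lt_powR_iff.
  have -> // : [set w | u `^ q^-1 / 2 < Z w] = [set w | u < 2 `^ q * Z w `^ q].
  apply/funext => w /=; rewrite -powRM// lt_powR_iff ?mulr_ge0//.
  by congr is_true; apply/idP/idP; lra.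
rewrite !ge0_expectationZl ?powR_ge0//; [|exact: measurable_powR_fun|
  by move=> w; exact: powR_ge0|exact: measurable_powR_fun|
  by move=> w; exact: powR_ge0].
rewrite EZ Ex -!EFinM -!EFinD !lee_fin => hx.
have D0 : 0 < 2 `^ q :> R by exact: powR_gt0.
have D1 : 2 `^ q * 2^-1 `^ q = 1 :> R by rewrite -powRM// divff// powR1.
rewrite !powRM ?mulr_ge0 ?powR_ge0// powR_invK// ?gt_eqF//.
set S := (4 * t0 + 2 * m) `^ q.
have h1 : (4 * t0) `^ q <= S.
  apply: ge0_ler_powR; rewrite ?nnegrE ?mulr_ge0//; first exact: ltW.
  by rewrite lerDl mulr_ge0.
have h2 : 2 `^ q * m `^ q <= S.
  rewrite -powRM//; apply: ge0_ler_powR; rewrite ?nnegrE ?mulr_ge0//.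
    exact: ltW.
  by rewrite lerDr mulr_ge0.
have : 2 `^ q * (2^-1 `^ q * x) <= 2 `^ q * (S + delta * x + S).
  apply: ler_wpM2l; [exact: ltW|apply: le_trans hx _].
  by rewrite lerD// lerD.
rewrite mulrA D1 mul1r => h3.
have : delta * 2 `^ q * x <= 2^-1 * x by rewrite ler_wpM2r.
move: h3; rewrite !mulrDr; lra.
Qed.

End absorption.

(** * Moment inequality *)

Section moment_inequality.
Context (R : realType) (p0 : R) (hp0 : 0 < p0).
Context (G : metricSemigroupType R) (z0 z1 : G).
Context d (T : measurableType d) (P : probability T R).
Context (n : nat) (X : 'I_n.+1 -> T -> G).
Hypothesis sepG : separable G.
Hypotheses (mX : forall i, random_element (X i)) (indX : independent P X).
Context (p q : R) (p0p : p0 <= p) (pq : p <= q).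

Let U := max_partial_dist z0 z1 X.
Let M := max_step_dist z0 X.
Let K := q / Num.max p (ln (q + ln 16)).

Let mU : measurable_fun setT U.
Proof. exact: measurable_max_partial_dist. Qed.

Let mM : measurable_fun setT M.
Proof. exact: measurable_max_step_dist. Qed.

Let p_gt0 : 0 < p. Proof. exact: lt_le_trans p0p. Qed.
Let q_gt0 : 0 < q. Proof. exact: lt_le_trans pq. Qed.

Let max_gt0 : 0 < Num.max p (ln (q + ln 16)).
Proof. by rewrite lt_max p_gt0. Qed.

Let K_gt0 : 0 < K. Proof. exact: divr_gt0. Qed.

Let BK_ge1 : 1 <= block_constant p0 * K.
Proof. by rewrite /K mulrA ler_pdivlMr// mul1r max_ln_le. Qed.

Lemma pr_gt_level (u eta : R) : 0 < eta -> moment_root P U p = u%:E ->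
  pr P [set w | level_constant p0 * (u + eta) < U w] <= expR (- p) / 2.
Proof.
move=> eta0 Uu.
have u0 : 0 <= u by rewrite -lee_fin -Uu poweR_ge0.
have A0 : 0 < level_constant p0 by apply: lt_le_trans (level_constant_ge1 hp0).
have ue0 : 0 < u + eta by rewrite ltr_wpDl.
have a0 : 0 < level_constant p0 * (u + eta) by rewrite mulr_gt0.
have := chebyshev_moment mU (max_partial_dist_ge0 z0 z1 X) a0 p_gt0 Uu.
rewrite powRM; [|exact: ltW..].
set h := pr _ _ => hu.
have up : u `^ p <= (u + eta) `^ p.
  by apply: ge0_ler_powR; rewrite ?nnegrE ?lerDl//; exact: ltW.
have h1 : h * level_constant p0 `^ p <= 1.
  rewrite -(ler_pM2r (powR_gt0 p ue0)) mul1r -mulrA.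
  exact: le_trans hu up.
have Ap : expR p * 2 <= level_constant p0 `^ p.
  rewrite /level_constant powRM ?expR_ge0 ?powR_ge0// -expRM mul1r.
  apply: ler_wpM2l; first exact: expR_ge0.
  rewrite -powRrM -[leLHS]powRr1//; apply: ler_powR; first by rewrite ler1n.
  by rewrite mulrC ler_pdivlMr// mul1r.
rewrite expRN -invfM -[leRHS]mul1r ler_pdivlMr ?mulr_gt0 ?expR_gt0//.
by apply: le_trans h1; rewrite ler_wpM2l ?pr_ge0.
Qed.

(** The distance is deterministic: one outcome with U <= a and M <= s is
    enough. *)
Lemma mdist_le_of_tails a s : pr P [set w | a < U w] + pr P [set w | s < M w] < 1 ->
  mdist z1 z0 <= a + s.
Proof.
move=> lt1; rewrite leNgt; apply/negP => asd.
have mUa := measurable_gt a mU; have mMs := measurable_gt s mM.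
have : pr P setT <= pr P ([set w | a < U w] `|` [set w | s < M w]).
  apply: pr_le => //; first exact: measurableU.
  move=> w _; have [?|Ua] := ltP a (U w); first by left.
  right; have := mdist_le_max z0 z1 X w; rewrite -/U -/M /=; lra.
have -> : pr P setT = 1 by rewrite /pr probability_setT.
have := prU_le P mUa mMs; lra.
Qed.

Lemma pr_gt_high_level (a s : R) k : 0 <= a -> 0 <= s ->
  pr P [set w | a < U w] <= expR (- p) / 2 ->
  pr P [set w | s < M w] <= expR (- q) / 8 ->
  chain_constant p0 * K <= k%:R ->
  pr P [set w | 2 * k.+1%:R * (a + s) < U w] * 2 `^ q <= 2^-1 /\
  mdist z1 z0 <= a + s.
Proof.
move=> a0 s0 ha hs hk.
have ep1 : expR (- p) <= 1 by rewrite -expR0 ler_expR oppr_le0 ltW.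
have eq1 : expR (- q) <= 1 by rewrite -expR0 ler_expR oppr_le0 ltW.
have das : mdist z1 z0 <= a + s by apply: mdist_le_of_tails; lra.
split => //.
have h1 : pr P [set w | a < U w] < 1 by lra.
have := pr_max_gt_chain sepG mX indX k a0 s0 das h1; rewrite -/U -/M => H.
have hl : pr P [set w | a < U w] / (1 - pr P [set w | a < U w]) <= expR (- p).
  rewrite ler_pdivrMr ?subr_gt0//.
  move: (pr_ge0 P [set w | a < U w]) ha ep1 (expR_ge0 (- p)).
  move: (pr _ _) (expR _) => x y; nra.
have hd : pr P [set w | 2 * k.+1%:R * (a + s) < U w] <=
          expR (- q) / 8 + expR (- q) / 4.
  apply: le_trans H _; apply: lerD => //.
  apply: le_trans (chain_bound_le hp0 p0p pq hk).
  apply: ler_wpM2r; first by rewrite invr_ge0 ler0n.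
  apply: lerXn2r; rewrite ?nnegrE ?expR_ge0//.
  by rewrite divr_ge0 ?pr_ge0// subr_ge0 ltW.
have e2 : 2 `^ q <= expR q.
  rewrite -[q in expR q]mul1r expRM.
  apply: ge0_ler_powR; rewrite ?nnegrE ?expR_ge0//.
    exact: ltW.
  by have := expR_ge1Dx (1 : R); lra.
apply: le_trans (ler_pM (pr_ge0 _ _) (powR_ge0 _ _) hd e2) _.
have : expR (- q) * expR q = 1 by rewrite mulrC expRxMexpNx_1.
rewrite mulrDl; lra.
Qed.

(** The slack eta makes the level a positive when the moments of U vanish, and
    puts s strictly above the rearrangement of M. *)
Lemma moment_root_max_le_slack (u m mq eta : R) : 0 < eta ->
  moment_root P U p = u%:E ->
  decreasing_rearrangement P M (expR (- q) / 8) = m%:E ->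
  moment_root P M q = mq%:E ->
  (moment_root P U q <=
   (theorem_constant p0 * K * (u + m + 2 * eta) + theorem_constant p0 * mq)%:E)%E.
Proof.
move=> eta0 Uu Mm Mq.
have u0 : 0 <= u by rewrite -lee_fin -Uu poweR_ge0.
have m0 : 0 <= m by rewrite -lee_fin -Mm decreasing_rearrangement_ge0.
have mq0 : 0 <= mq by rewrite -lee_fin -Mq poweR_ge0.
have A1 := level_constant_ge1 hp0.
have C1 := chain_constant_ge1 hp0.
pose a := level_constant p0 * (u + eta).
pose s := m + eta.
have a0 : 0 <= a by rewrite mulr_ge0 ?(le_trans _ A1)// addr_ge0// ltW.
have s0 : 0 <= s by rewrite addr_ge0// ltW.
have CK0 : 0 <= chain_constant p0 * K.
  by apply: mulr_ge0; [exact: le_trans C1|exact: ltW].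
(* The next integer; block_constant * K >= 1 pays for the rounding. *)
pose k := (Num.truncn (chain_constant p0 * K)).+1.
have /andP[k1 /ltW k2] := truncn_itv CK0.
have [hd das] := pr_gt_high_level a0 s0 (pr_gt_level eta0 Uu)
  (pr_gt_rearrangement mM Mm eta0) k2.
rewrite -/k in hd.
pose t0 := 2 * k.+1%:R * (a + s).
have as0 : 0 <= a + s by rewrite addr_ge0.
have ast : a + s <= t0.
  rewrite /t0 ler_peMl// -[leLHS]mulr1 ler_pM// ler1n//.
have t00 : 0 <= t0 by apply: le_trans ast.
have EMq := moment_root_fin q_gt0 Mq.
have H t : 4 * t0 <= t -> pr P [set w | 2 * t < U w] <=
     pr P [set w | t0 < U w] * pr P [set w | t < U w] + pr P [set w | t / 2 < M w].
  move=> tt; have t_ge0 : 0 <= t by apply: le_trans tt; rewrite mulr_ge0.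
  have dt : mdist z1 z0 <= t by move: das ast tt t00; lra.
  have := pr_max_gt_two_blocks sepG mX indX t_ge0 t00
            (divr_ge0 t_ge0 (ler0n R 2)) dt.
  rewrite -/U -/M => H2.
  rewrite [leRHS]addrC (mulrC (pr P [set w | t0 < U w])); apply: le_trans H2.
  apply: pr_le; [exact: measurable_gt|exact: measurable_gt|move=> w /=].
  move: tt; lra.
apply: le_trans (moment_root_le_of_halving mU mM _ _ q_gt0 t00 (pr_ge0 P _)
                   mq0 hd EMq _ H) _.
- exact: max_partial_dist_ge0.
- exact: max_step_dist_ge0.
- apply: (moment_lty_of_le mU mM _ _ q_gt0 (mdist_ge0 z1 z0) (ler0n R n.+1)
            _ EMq).
  + exact: max_partial_dist_ge0.
  + exact: max_step_dist_ge0.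
  + exact: max_partial_dist_le.
rewrite lee_fin.
have q4 : 4 `^ q^-1 <= 4 `^ p0^-1 :> R.
  by apply: ler_powR; rewrite ?ler1n// lef_pV2 ?posrE// (le_trans p0p).
have S0 : 0 <= u + m + 2 * eta by rewrite !addr_ge0// mulr_ge0// ltW.
have ht : t0 <= 2 * ((chain_constant p0 + 2 * block_constant p0) * K) *
                (level_constant p0 * (u + m + 2 * eta)).
  rewrite /t0; apply: ler_pM => //; rewrite ?mulr_ge0//.
    rewrite ler_pM2l// mulrDl -[2 * _ * _]mulrA /k -natr1 -natr1.
    move: k1 BK_ge1; lra.
  have : m + eta <= level_constant p0 * (m + eta) by rewrite ler_peMl.
  rewrite /a /s !mulrDr; lra.
apply: (@le_trans _ _ (4 `^ p0^-1 * (2 * (4 * t0 + 2 * mq)))).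
  by rewrite ler_wpM2r// mulr_ge0// addr_ge0 ?mulr_ge0.
have c4 := theorem_constant_ge hp0.
have P0 : 0 <= 4 `^ p0^-1 :> R by exact: powR_ge0.
have hm : 4 * 4 `^ p0^-1 * mq <= theorem_constant p0 * mq by rewrite ler_wpM2r.
have ht2 : 4 `^ p0^-1 * (8 * t0) <= theorem_constant p0 * K * (u + m + 2 * eta).
  apply: (@le_trans _ _ (4 `^ p0^-1 *
      (8 * (2 * ((chain_constant p0 + 2 * block_constant p0) * K) *
            (level_constant p0 * (u + m + 2 * eta)))))).
    by rewrite ler_wpM2l// ler_wpM2l.
  by rewrite /theorem_constant le_eqVlt; apply/orP; left; apply/eqP; ring.
move: hm ht2; lra.
Qed.

Lemma moment_root_max_le (u m mq : R) :
  moment_root P U p = u%:E ->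
  decreasing_rearrangement P M (expR (- q) / 8) = m%:E ->
  moment_root P M q = mq%:E ->
  (moment_root P U q <=
   (theorem_constant p0 * K * (u + m) + theorem_constant p0 * mq)%:E)%E.
Proof.
move=> Uu Mm Mq; apply/lee_addgt0Pr => e e0.
have cK0 : 0 < theorem_constant p0 * K by rewrite mulr_gt0// theorem_constant_gt0.
have eta0 : 0 < e / (2 * (theorem_constant p0 * K)).
  by rewrite divr_gt0// mulr_gt0.
apply: le_trans (moment_root_max_le_slack eta0 Uu Mm Mq) _.
rewrite -EFinD lee_fin le_eqVlt; apply/orP; left; apply/eqP.
move: cK0; move: (theorem_constant p0) (K) => c L cL; field.
by move: cL; rewrite lt0r mulf_eq0 negb_or => /andP[/andP[-> ->] _].
Qed.

(** Chebyshev's inequality at a level whose tail exceeds exp (- q) / 8. *)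
Lemma rearrangement_le_moment :
  (decreasing_rearrangement P M (expR (- q) / 8) <=
   (8 `^ p0^-1 * expR 1)%:E * moment_root P M q)%E.
Proof.
have B0 : 0 < 8 `^ p0^-1 * expR 1 :> R by rewrite mulr_gt0 ?powR_gt0 ?expR_gt0.
have : (0 <= moment_root P M q)%E by exact: poweR_ge0.
case Mq : (moment_root P M q) => [mq| |]//; last first.
  by rewrite gt0_muley ?leey ?lte_fin.
rewrite lee_fin => mq0; rewrite -EFinM.
apply: decreasing_rearrangement_le => // [|y y0 hy]; first by rewrite mulr_ge0// ltW.
have := chebyshev_moment mM (max_step_dist_ge0 z0 X) y0 q_gt0 Mq => hc.
apply: (@le_trans _ _ (8 `^ q^-1 * expR 1 * mq)); last first.
  apply: ler_wpM2r => //; apply: ler_wpM2r; first exact: expR_ge0.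
  by apply: ler_powR; rewrite ?ler1n// lef_pV2 ?posrE// (le_trans p0p).
rewrite -(@le_powR_iff _ _ _ q) ?mulr_ge0 ?powR_ge0 ?expR_ge0 ?(ltW y0)//.
rewrite !powRM ?mulr_ge0 ?powR_ge0 ?expR_ge0// powR_invK ?gt_eqF// -expRM mul1r.
have yq : 0 < y `^ q by exact: powR_gt0.
have : expR (- q) / 8 * y `^ q <= mq `^ q.
  by apply: le_trans hc; rewrite ler_wpM2r ?ltW.
rewrite -(ler_pM2l (expR_gt0 q)) !mulrA expRxMexpNx_1; lra.
Qed.

End moment_inequality.

Theorem theorem2 (R : realType) (p0 : R) (hp0 : 0 < p0) :
  exists c c' : R, [/\ 0 < c, 0 < c' &
    forall (G : metricSemigroupType R) (z0 z1 : G)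
      (d : measure_display) (T : measurableType d) (P : probability T R)
      (n : nat) (X : 'I_n.+1 -> T -> G) (p q eps : R),
    separable G -> abelian_semigroup G ->
    (forall i, random_element (X i)) -> independent P X ->
    p0 <= p -> p <= q -> - q < eps -> eps <= ln 16 ->
    let U := max_partial_dist z0 z1 X in
    let M := max_step_dist z0 X in
    let K := q / Num.max p (ln (eps + q)) in
    let rhs := ((c * K)%:E *
        (moment_root P U p + decreasing_rearrangement P M (expR (- q) / 8)) +
        c%:E * moment_root P M q)%E in
    let rhs' (k : R) :=
      ((k * K)%:E * (moment_root P U p + moment_root P M q))%E in
    (moment_root P U q <= rhs)%E /\
    (Num.min 1 (expR 1 - p0) <= eps ->
       (rhs <= rhs' c')%E /\
       (rhs <= rhs' (c * (8 `^ p0^-1 * expR 1 +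
                          Num.max 1 (ln (eps + p0) / p0)))%R)%E)].
Proof.
pose c := theorem_constant p0.
have c0 : 0 < c by exact: theorem_constant_gt0.
pose b (eps : R) := 8 `^ p0^-1 * expR 1 + Num.max 1 (ln (eps + p0) / p0).
have B0 : 0 < 8 `^ p0^-1 * expR 1 :> R by rewrite mulr_gt0 ?powR_gt0 ?expR_gt0.
have b1 eps : 1 <= Num.max 1 (ln (eps + p0) / p0) by rewrite le_max lexx.
have b0 eps : 0 < b eps by rewrite /b; have := b1 eps; move: B0; lra.
exists c, (c * b (ln 16)); split => //; first by rewrite mulr_gt0.
move=> G z0 z1 d T P n X p q eps sepG _ mX indX p0p pq qeps eps16 U M K rhs rhs'.
have p_gt0 : 0 < p by exact: lt_le_trans p0p.
have q_gt0 : 0 < q by exact: lt_le_trans pq.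
have eq0 : 0 < eps + q by rewrite -ltrBlDr sub0r.
have max0 x : 0 < Num.max p x by rewrite lt_max p_gt0.
have K0 : 0 < K by rewrite divr_gt0.
have cK0 : 0 < c * K by rewrite mulr_gt0.
have Uge0 : (0 <= moment_root P U p)%E by exact: poweR_ge0.
have Mge0 : (0 <= moment_root P M q)%E by exact: poweR_ge0.
have Sge0 := decreasing_rearrangement_ge0 P M (expR (- q) / 8).
have nNy (x : \bar R) : (0 <= x)%E -> x != -oo%E by case: x.
have cM0 : (0 <= c%:E * moment_root P M q)%E by rewrite mule_ge0// lee_fin ltW.
split.
  rewrite /rhs.
  case Uu : (moment_root P U p) Uge0 => [u| |]// u0; last first.
    by rewrite addye ?nNy// gt0_muley ?lte_fin// addye ?leey// nNy.
  case Mm : (decreasing_rearrangement _ _ _) Sge0 => [m| |]// m0; last first.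
    by rewrite addey// gt0_muley ?lte_fin// addye ?leey// nNy.
  case Mq : (moment_root P M q) Mge0 => [mq| |]// mq0; last first.
    by rewrite gt0_muley ?lte_fin// addey ?leey.
  apply: le_trans (moment_root_max_le hp0 sepG mX indX p0p pq Uu Mm Mq) _.
  rewrite -EFinD lee_fin lerD2r -/c.
  rewrite !lee_fin in u0 m0.
  apply: ler_wpM2r; first exact: addr_ge0.
  apply: ler_wpM2l; first exact: ltW.
  apply: ler_wpM2l; first exact: ltW.
  (* K decreases with eps, and eps <= ln 16. *)
  rewrite lef_pV2 ?posrE//.
  rewrite ge_max !le_max lexx/=; apply/orP; right.
  rewrite ler_ln ?posrE//; last by rewrite ltr_wpDr// ln_ge0// ler1n.
  by rewrite addrC lerD2l.
move=> epsp0.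
have eps_p0 : 0 < eps + p0.
  move: epsp0; rewrite ge_min => /orP[h|h]; first by move: h hp0; lra.
  by have := expR_gt0 (1 : R); move: h; lra.
have rhs_le : (rhs <= rhs' (c * b eps)%R)%E.
  rewrite /rhs /rhs'.
  have bK : 0 < c * b eps * K by rewrite mulr_gt0// mulr_gt0// b0.
  have Sle := rearrangement_le_moment hp0 z0 P mX p0p pq.
  rewrite -/M in Sle.
  case Uu : (moment_root P U p) Uge0 => [u| |]// u0; last first.
    by rewrite [in leRHS]addye ?nNy// [in leRHS]gt0_muley ?leey ?lte_fin.
  case Mq : (moment_root P M q) Mge0 Sle => [mq| |]// mq0; last first.
    by move=> _; rewrite [in leRHS]addey ?gt0_muley ?leey ?lte_fin.
  case: (decreasing_rearrangement _ _ _) Sge0 => [m| |]// m0.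
  rewrite -EFinM lee_fin => mB.
  rewrite -!EFinD -?EFinM -?EFinD lee_fin.
  rewrite !lee_fin in u0 m0 mq0.
  have Kb : 1 <= K * Num.max 1 (ln (eps + p0) / p0).
    rewrite /K mulrAC ler_pdivlMr// mul1r ge_max; apply/andP; split.
      by apply: le_trans pq _; rewrite ler_peMr// ltW.
    by apply: ln_add_le => //; exact: le_trans pq.
  have h1 : c * K * m <= c * K * (8 `^ p0^-1 * expR 1 * mq) by rewrite ler_pM2l.
  have h2 : c * mq * 1 <= c * mq * (K * Num.max 1 (ln (eps + p0) / p0)).
    by rewrite ler_wpM2l// mulr_ge0// ltW.
  have h3 : c * K * u * 1 <= c * K * u * b eps.
    apply: ler_wpM2l; first by rewrite mulr_ge0// ltW.
    by rewrite /b; have := b1 eps; move: B0; lra.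
  move: h1 h2 h3; rewrite /b.
  move: (8 `^ p0^-1 * expR 1) (Num.max 1 _) (K) => B x L; lra.
split; last exact: rhs_le.
apply: le_trans rhs_le _; rewrite /rhs'.
apply: lee_wpmul2r; first exact: adde_ge0.
rewrite lee_fin; apply: ler_wpM2r; first exact: ltW.
apply: ler_wpM2l; first exact: ltW.
rewrite /b lerD2l ge_max le_max lexx/= le_max; apply/orP; right.
apply: ler_wpM2r; first by rewrite invr_ge0 ltW.
by rewrite ler_ln ?posrE ?lerD2r// ltr_wpDl// ln_ge0// ler1n.
Qed.
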